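(* Let $\xi_3=e^{2\pi i/3}$ and let $V_2=\mathbb{Q}(\xi_3)^2$ be the standard representation of $GL_2(\mathbb{Z}[\xi_3])$. For every integer $n\ge0$, $\chi_h(GL_2(\mathbb{Z}[\xi_3]),S^nV_2)=1$ if $n\equiv 0\pmod 6$ and $\chi_h(GL_2(\mathbb{Z}[\xi_3]),S^nV_2)=0$ otherwise.
   Context: $S^n$ denotes the $n$-th symmetric power (over $\mathbb{Q}(\xi_3)$), and $\chi_h(\Gamma,V)=\sum_j(-1)^j\dim_{\mathbb{Q}(\xi_3)}H^j(\Gamma,V)$. *)

(* Defs.v *)
From HB Require Import structures.
From mathcomp Require Import all_boot all_order all_algebra all_field.
Set Implicit Arguments. Unset Strict Implicit. Unset Printing Implicit Defensive.
Import Order.TTheory GRing.Theory Num.Theory.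
Local Open Scope ring_scope.

(* xi3 = e^{2 pi i/3} = (-1 + i sqrt 3)/2 inside the algebraic complex numbers *)
Definition xi3 : algC := (-1 + sqrtC (-3)) / 2.

Definition inQxi (x : algC) : Prop := exists a b : rat, x = ratr a + ratr b * xi3.
Definition inZxi (x : algC) : Prop := exists a b : int, x = a%:~R + b%:~R * xi3.

Definition i0 : 'I_2 := ord0.
Definition i1 : 'I_2 := ord_max.

Definition inGL2Zxi (g : 'M[algC]_2) : Prop :=
  (forall i j, inZxi (g i j)) /\ exists u, inZxi u /\ \det g * u = 1.

(* the matrix of g acting on S^n V_2 in the basis e1^(n-k) e2^k (k = 0..n),
   computed after dehomogenising e1 = 1, e2 = 'X; g e1 = g11 e1 + g21 e2, etc. *)
Definition symmx (n : nat) (g : 'M[algC]_2) : 'M[algC]_(n.+1) :=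
  \matrix_(i < n.+1, k < n.+1)
    ((((g i0 i0)%:P + (g i1 i0)%:P * 'X) ^+ (n - k) *
      ((g i0 i1)%:P + (g i1 i1)%:P * 'X) ^+ k)`_i).

Definition inSnV (n : nat) (v : 'cV[algC]_(n.+1)) : Prop := forall i, inQxi (v i 0).

(* inhomogeneous cochains: only values on size-j sequences of elements of Gamma matter *)
Definition cochain (n : nat) := seq 'M[algC]_2 -> 'cV[algC]_(n.+1).

Definition allGamma (s : seq 'M[algC]_2) : Prop := forall g, g \in s -> inGL2Zxi g.

Definition dcoch (n j : nat) (f : cochain n) (s : seq 'M[algC]_2) : 'cV[algC]_(n.+1) :=
  symmx n (head 0 s) *m f (behead s)
  + \sum_(i < j) (-1) ^+ i.+1 *: f (take i s ++ (nth 0 s i *m nth 0 s i.+1) :: drop i.+2 s)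
  + (-1) ^+ j.+1 *: f (take j s).

Definition is_cochain (n j : nat) (f : cochain n) : Prop :=
  forall s, allGamma s -> size s = j -> inSnV (f s).

Definition is_cocycle (n j : nat) (f : cochain n) : Prop :=
  is_cochain j f /\ forall s, allGamma s -> size s = j.+1 -> dcoch j f s = 0.

Definition is_coboundary (n j : nat) (f : cochain n) : Prop :=
  match j with
  | 0 => f [::] = 0
  | j'.+1 => exists h : cochain n, is_cochain j' h /\
               forall s, allGamma s -> size s = j -> f s = dcoch j' h s
  end.

Definition dimH (n j d : nat) : Prop :=
  exists z : 'I_d -> cochain n,
    (forall i, is_cocycle j (z i)) /\
    (forall f, is_cocycle j f -> exists c : 'I_d -> algC,
        (forall i, inQxi (c i)) /\
        is_coboundary j (fun s => f s - \sum_(i < d) c i *: z i s)) /\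
    (forall c : 'I_d -> algC, (forall i, inQxi (c i)) ->
        is_coboundary j (fun s => \sum_(i < d) c i *: z i s) -> forall i, c i = 0).

Definition chi_h_is (n : nat) (e : int) : Prop :=
  exists (N : nat) (d : nat -> nat),
    (forall j, dimH n j (d j)) /\ (forall j, (N < j)%N -> d j = 0%N) /\
    \sum_(j < N.+1) (-1) ^+ j * (d j)%:Z = e.

(* Main.v *)
Require Import Defs.
From mathcomp Require Import all_boot all_order all_algebra all_field.
From HB Require Import structures.
From mathcomp Require Import boolp.
From mathcomp Require Import ring zify.
Set Implicit Arguments. Unset Strict Implicit. Unset Printing Implicit Defensive.
Import Order.TTheory GRing.Theory Num.Theory.
Local Open Scope ring_scope.

(* Gamma = GL_2(Z[w]) permutes the ideal regular tetrahedra tessellating hyperbolic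
   3-space; the dual 2-complex has tetrahedra as vertices, ideal triangles as edges
   and ideal edges as hexagons. V-valued cochains on it give a resolution
   0 -> V -> A0 -> A1 -> A2 -> 0, where A_p consists of the functions on Gamma that
   are (semi-)invariant under a finite stabilizer H_p, so that A_p is acyclic by
   averaging and H^*(Gamma, V) is the cohomology of V^H0 -> V^H1 -> V^H2.
   Exactness is discrete Morse theory: the vertices of a tetrahedron have positive
   integer norms m_i with sum m_i^2 - sum_(i < j) m_i m_j = -2, and reflection in a face
   replaces m_i by the sum of the others minus m_i. With height sum m_i, the
   tetrahedron (1,1,1,1) is the only minimum, at most two faces of a tetrahedron are
   descending, and every hexagon has a unique top.
   Hence chi = dim V^H0 - dim V^H1 + dim V^H2, which is a sum of traces of
   symmetric powers over the three stabilizers: scalar matrices cancel, and the other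
   contributions are 12-periodic in n by the linear recurrence for traces. *)

(** * Inhomogeneous cochains *)

(** The modules A_p consist of functions on the group itself because the two sides then do separate
    jobs. Left translation carries the coefficients and gives an explicit contracting homotopy of
    the cochain complex. Right multiplication by elements of the group ring gives the differentials,
    the invariance conditions and the averaging, and commutes with the cochain differential. The
    norms m_i are the values of one positive definite Hermitian form at the four ideal vertices.
    Binary Hermitian forms have four real coordinates, so these values determine the form, and the
    quadratic relation between them is its determinant. Integrality and positivity make the height a
    well-founded measure. Modulo the six scalars the stabilizers have orders 12, 6 and 12. The
    scalars cancel because 1/12 - 1/6 + 1/12 = 0; this matters since their traces grow linearly with
    n and would otherwise spoil periodicity. *)

Section BarComplex.
Variables (K : fieldType) (V : lmodType K) (G : groupType) (rho : G -> V -> V).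
Hypothesis rhoM : forall g h v, rho (g * h)%g v = rho g (rho h v).
Hypothesis rho1 : forall v, rho 1%g v = v.
Hypothesis rhoP : forall g k u v, rho g (u + k *: v) = rho g u + k *: rho g v.

Implicit Types (c : seq G -> G -> V) (s : seq G) (x g : G) (v : V) (L : seq (K * G)).

Lemma rhoD g u v : rho g (u + v) = rho g u + rho g v.
Proof. by rewrite -[v]scale1r rhoP !scale1r. Qed.

Lemma rho0 g : rho g 0 = 0.
Proof. by apply: (addIr (rho g 0)); rewrite -rhoD !addr0 add0r. Qed.

Lemma rhoZ g k v : rho g (k *: v) = k *: rho g v.
Proof. by rewrite -[k *: v]add0r rhoP rho0 add0r. Qed.

Lemma rhoN g v : rho g (- v) = - rho g v.
Proof. by rewrite -scaleN1r rhoZ scaleN1r. Qed.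

Lemma rho_sum g I (r : seq I) (P : pred I) F :
  rho g (\sum_(i <- r | P i) F i) = \sum_(i <- r | P i) rho g (F i).
Proof. exact: (big_morph _ (rhoD g) (rho0 g)). Qed.

Lemma rho_inj g : injective (rho g).
Proof. by move=> u v /(congr1 (rho g^-1)); rewrite -!rhoM mulVg !rho1. Qed.

(* Coefficients in the G-module of functions phi : G -> V with
   (g phi)(x) = g phi(g^-1 x); V itself is the submodule of constant functions. *)
Definition bard (j : nat) c s x : V :=
  rho (head 1%g s) (c (behead s) ((head 1 s)^-1 * x)%g)
  + \sum_(i < j) (-1) ^+ i.+1 *:
      c (take i s ++ (nth 1 s i * nth 1 s i.+1)%g :: drop i.+2 s) x
  + (-1) ^+ j.+1 *: c (take j s) x.

Lemma bard_ext j c c' s x :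
  (forall s x, size s = j -> c s x = c' s x) -> size s = j.+1 ->
  bard j c s x = bard j c' s x.
Proof.
move=> Hc Hs; rewrite /bard !Hc; last 2 first.
- by rewrite size_take Hs ltnSn.
- by rewrite size_behead Hs.
congr (_ + _ + _); apply: eq_bigr => i _; rewrite Hc //.
have Hi := ltn_ord i.
by rewrite size_cat size_take /= size_drop Hs; case: ifP; lia.
Qed.

Lemma bard_lin j c c' k s x :
  bard j (fun s x => c s x + k *: c' s x) s x = bard j c s x + k *: bard j c' s x.
Proof.
rewrite /bard rhoP !scalerDr !scalerA.
under eq_bigr do rewrite scalerDr scalerA [_ * k]mulrC -scalerA.
rewrite big_split /= [_ * k]mulrC -scaler_sumr -!scalerA.
by rewrite [X in X + _ = _]addrACA [LHS]addrACA.
Qed.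

Lemma bard_shift j c g s x :
  bard j (fun s x => c s (x * g)%g) s x = bard j c s (x * g)%g.
Proof. by rewrite /bard mulgA. Qed.

(** The argument x is translated to 1 and recorded as a new first entry. Only functions on G have
    room for this, and it contracts their cochain complex. *)
Definition bars c s x : V := rho x (c (x^-1%g :: s) 1%g).

Lemma bard_homotopy j c s x : size s = j.+1 ->
  bard j (bars c) s x + bars (bard j.+1 c) s x = c s x.
Proof.
case: s => // g s [Hs]; rewrite /bard /bars /= -rhoM mulVKg invgM invgK.
rewrite big_ord_recl /= !rhoD rho_sum /= drop0 -rhoM mulgV rho1 mulg1.
rewrite !rhoZ /= expr1 !scaleN1r invgK.
under [X in _ + (_ + (_ + X) + _)]eq_bigr => i _ do
  rewrite rhoZ /= /bump leq0n !add1n !add0n exprS mulN1r scaleNr.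
rewrite sumrN [(-1) ^+ j.+2]exprS mulN1r scaleNr.
by rewrite -opprD -[X in _ + X]addrA -opprD [LHS]addrC subrK.
Qed.

(** Induction through the homotopy avoids the double sum over faces. From ds + sd = 1 one gets
    d(s(dc)) = dc - d(d(sc)) = dc by induction, hence s(d(dc)) = 0. This is vanishing at the
    argument 1, and [bard_shift] carries it to every x. *)
Lemma bard_bard j c s x : size s = j.+2 -> bard j.+1 (bard j c) s x = 0.
Proof.
elim: j c s x => [|j IH] c s x.
  case: s => [|g [|h [|]]] //= _.
  rewrite /bard /= !big_ord_recl !big_ord0 /= !addr0 !expr1 sqrrN expr1n !scaleN1r scale1r.
  rewrite rhoD rhoN -rhoM invgM !mulgA opprB [X in X + _ = _]addrC [X in X + _ = _]addrA subrK.
  by rewrite addrA subrK subrr.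
suff main c0 g s' : size s' = j.+2 -> bard j.+2 (bard j.+1 c0) (g :: s') 1%g = 0.
  case: s => // g s [Hs]; rewrite -[x]mul1g -bard_shift.
  have -> : (fun s y => bard j.+1 c s (y * x)%g) =
            bard j.+1 (fun s y => c s (y * x)%g).
    by apply/funext => s'; apply/funext => y; rewrite bard_shift.
  exact: main.
move=> Hs; rewrite -[g]invgK; apply: (@rho_inj g^-1%g); rewrite rho0.
have := bard_homotopy (bard j.+1 c0) g^-1%g Hs.
rewrite (@bard_ext _ _ (fun s x => c0 s x + (-1) *: bard j (bars c0) s x)) //; last first.
  move=> s1 x1 Hs1; rewrite -(bard_homotopy c0 x1 Hs1).
  by rewrite scaleN1r [RHS]addrC addKr.
by rewrite (bard_lin j.+1 c0 (bard j (bars c0))) IH // scaler0 addr0 => /(canRL (addKr _)); rewrite addNr.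
Qed.

(** Right multiplication by a group ring element, linear for the action of G on functions. Averaging
    operators and differentials of the resolution both take this form. *)
Definition radd L (phi : G -> V) : G -> V :=
  fun x => \sum_(p <- L) p.1 *: phi (x * p.2)%g.

Lemma radd_lin L phi psi k x :
  radd L (fun x => phi x + k *: psi x) x = radd L phi x + k *: radd L psi x.
Proof.
rewrite /radd scaler_sumr -big_split; apply: eq_bigr => p _ /=.
by rewrite scalerDr !scalerA mulrC.
Qed.

Lemma radd_ext L phi psi x : phi =1 psi -> radd L phi x = radd L psi x.
Proof. by move=> e; apply: eq_bigr => p _; rewrite e. Qed.

Lemma bard_sum j I (r : seq I) (k : I -> K) (F : I -> seq G -> G -> V) s x :
  bard j (fun s x => \sum_(i <- r) k i *: F i s x) s x =
  \sum_(i <- r) k i *: bard j (F i) s x.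
Proof.
elim: r => [|i r IH].
  rewrite big_nil; under [fun _ _ => _]funext => s' do
    under [fun _ => _]funext => x' do rewrite big_nil.
  by rewrite /bard rho0 big1 => [|i _]; rewrite !scaler0 ?addr0.
rewrite big_cons -IH addrC -bard_lin; congr (bard j _ s x).
by apply/funext => s'; apply/funext => x'; rewrite big_cons addrC.
Qed.

Lemma bard_radd j L c s x : bard j (fun s => radd L (c s)) s x = radd L (bard j c s) x.
Proof.
rewrite /radd bard_sum; apply: eq_bigr => p _; congr (_ *: _).
exact: bard_shift.
Qed.

Definition inv_fun v : G -> V := fun x => rho x v.
Definition lact L v : V := \sum_(p <- L) p.1 *: rho p.2 v.

(** Invariant functions are determined by their value at 1. On them right multiplication turns into
    the action on V, which makes the complex of invariants a complex of subspaces of V. *)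
Lemma radd_inv L v x : radd L (inv_fun v) x = inv_fun (lact L v) x.
Proof.
rewrite /radd /inv_fun /lact rho_sum; apply: eq_bigr => p _.
by rewrite rhoM rhoZ.
Qed.

Lemma bard_inv v g x : bard 0 (fun _ => inv_fun v) [:: g] x = 0.
Proof. by rewrite /bard /inv_fun big_ord0 expr1 -rhoM mulVKg addr0 scaleN1r subrr. Qed.

Lemma invariant_fun (phi : G -> V) :
  (forall g x, bard 0 (fun _ => phi) [:: g] x = 0) -> phi =1 inv_fun (phi 1%g).
Proof.
move=> H x; have /eqP := H x x.
by rewrite /bard big_ord0 expr1 addr0 scaleN1r subr_eq0 mulVg => /eqP <-.
Qed.
End BarComplex.

(** * Dimension of cohomology through a linear correspondence *)

Section CohomologyDimension.
Variables (K : fieldType) (V : vectType K) (G : groupType) (rho : G -> V -> V).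

Definition cst (f : seq G -> V) : seq G -> G -> V := fun s _ => f s.

Definition vcoc (j : nat) (f : seq G -> V) : Prop :=
  forall s x, size s = j.+1 -> bard rho j (cst f) s x = 0.

Definition vcob (j : nat) (f : seq G -> V) : Prop :=
  match j with
  | 0 => f [::] = 0
  | j'.+1 => exists h, forall s x, size s = j -> f s = bard rho j' (cst h) s x
  end.

Definition barH (j d : nat) : Prop :=
  exists z : 'I_d -> seq G -> V,
    [/\ forall i, vcoc j (z i),
        forall f, vcoc j f -> exists c : 'I_d -> K,
          vcob j (fun s => f s - \sum_(i < d) c i *: z i s) &
        forall c : 'I_d -> K, vcob j (fun s => \sum_(i < d) c i *: z i s) ->
          forall i, c i = 0].

(** A linear relation inducing an isomorphism of H^j with U/U'. Dimension shifting depends on chosen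
    preimages, and a relation absorbs these choices where a map would need them made linearly. *)
Lemma barH_of_rel j (U U' : {vspace V}) (Rel : (seq G -> V) -> V -> Prop) :
  (U' <= U)%VS ->
  (forall f, vcoc j f -> exists2 u, u \in U & Rel f u) ->
  (forall u, u \in U -> exists2 f, vcoc j f & Rel f u) ->
  (forall f f' u u' k, Rel f u -> Rel f' u' ->
     Rel (fun s => f s + k *: f' s) (u + k *: u')) ->
  (forall f u, Rel f u -> u \in U' <-> vcob j f) ->
  barH j (\dim U - \dim U').
Proof.
move=> sU R1 R2 R3 R4; pose W := (U :\: U')%VS.
have dW : \dim W = (\dim U - \dim U')%N.
  by rewrite -(dimv_cap_compl U U') (capv_idPr sU) addKn.
rewrite -dW {dW}; pose b := vbasis W.
have /choice[z zP] (i : 'I_(\dim W)) : exists f, vcoc j f /\ Rel f b`_i.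
  have [|f f1 f2] := R2 b`_i; last by exists f.
  by apply: (subvP (diffvSl U U')); apply: vbasis_mem; rewrite mem_nth ?size_tuple.
have Rsum f u (c : 'I_(\dim W) -> K) : Rel f u ->
    Rel (fun s => f s + \sum_i c i *: z i s) (u + \sum_i c i *: b`_i).
  move=> Rf; elim: (index_enum _) => [|i r IH].
    rewrite big_nil addr0; suff -> : (fun s => f s + \sum_(i <- [::]) c i *: z i s) = f by [].
    by apply/funext => s; rewrite big_nil addr0.
  rewrite big_cons addrCA addrC.
  suff -> : (fun s => f s + \sum_(i0 <- i :: r) c i0 *: z i0 s) =
            (fun s => (f s + \sum_(i0 <- r) c i0 *: z i0 s) + c i *: z i s).
    by apply: R3 => //; case: (zP i).
  by apply/funext => s; rewrite big_cons addrCA addrC.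
exists z; split=> [i|f fP|c cP i]; first by case: (zP i).
- have [u uU Rf] := R1 f fP.
  move: uU; rewrite -{1}(addv_diff_cap U U') (capv_idPr sU) => /memv_addP[w wW [u' u'U Du]].
  exists (fun i => coord b i w); apply/(R4 _ u').
    have := Rsum f u (fun i => - coord b i w) Rf; rewrite Du.
    have -> : w + u' + \sum_i - coord b i w *: b`_i = u'.
      under eq_bigr do rewrite scaleNr.
      by rewrite sumrN -(coord_vbasis wW) addrAC subrr add0r.
    congr (Rel _ _); apply/funext => s; congr (_ + _); rewrite -sumrN.
    by apply: eq_bigr => i _; rewrite scaleNr.
  by [].
have [f0 _ R0] := R2 0 (mem0v U).
have R00 : Rel (fun=> 0) 0.
  have := R3 _ _ _ _ (-1) R0 R0; rewrite scaler0 addr0; congr (Rel _ _).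
  by apply/funext => s; rewrite scaleN1r subrr.
have := Rsum _ _ c R00; rewrite add0r.
have -> : (fun s => 0 + \sum_i c i *: z i s) = (fun s => \sum_i c i *: z i s).
  by apply/funext => s; rewrite add0r.
move/R4/iffRL/(_ cP) => wU'.
have wW : \sum_i c i *: b`_i \in W.
  apply: memv_suml => k _; apply: memvZ; apply: vbasis_mem.
  by rewrite mem_nth ?size_tuple.
have /eqP w0 : \sum_i c i *: b`_i == 0.
  by rewrite -memv0 -(capv_diff U U') memv_cap wW.
by have /freeP := basis_free (vbasisP W); apply.
Qed.

Lemma barH_vanish j : (forall f, vcoc j f -> vcob j f) -> barH j 0.
Proof.
move=> H; exists (fun _ _ => 0); split=> [[]//|f /H fP|c _ []//].
exists (fun=> 0); have -> : (fun s => f s - \sum_(i < 0) 0 *: 0 : V) = f by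
  apply/funext => s; rewrite big_ord0 subr0.
by [].
Qed.
End CohomologyDimension.

(** * Cohomology from an acyclic resolution *)

Definition inA (K : fieldType) (V : lmodType K) (G : groupType)
  (E : seq (K * G)) (phi : G -> V) : Prop := radd E phi =1 phi.

Section AcyclicResolution.
Variables (K : fieldType) (V : vectType K) (G : groupType) (rho : G -> V -> V).
Hypothesis rhoM : forall g h v, rho (g * h)%g v = rho g (rho h v).
Hypothesis rho1 : forall v, rho 1%g v = v.
Hypothesis rhoP : forall g k u v, rho g (u + k *: v) = rho g u + k *: rho g v.

Implicit Types (E : seq (K * G)) (phi psi : G -> V) (v : V).

Lemma inA_lin E phi psi k :
  inA E phi -> inA E psi -> inA E (fun x => phi x + k *: psi x).
Proof. by move=> H1 H2 x; rewrite radd_lin H1 H2. Qed.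

Lemma inA_inv E v : inA E (inv_fun rho v) <-> lact rho E v = v.
Proof.
split=> [/(_ 1%g)|Hv x]; last by rewrite (radd_inv rhoM rhoP) Hv.
by rewrite (radd_inv rhoM rhoP) /inv_fun !rho1.
Qed.

Lemma bard_inA j E c : (forall s, size s = j -> inA E (c s)) ->
  forall s, size s = j.+1 -> inA E (bard rho j c s).
Proof.
move=> Hc s Hs x; rewrite -(bard_radd rhoP).
by apply: bard_ext => // s' x' /Hc.
Qed.

(** The homotopy gives a primitive of c among all functions. Applying the idempotent E moves it into
    the module cut out by E and preserves the equation, since c is fixed by E and [radd] commutes
    with [bard]. *)
Lemma acyclic_inA E j c :
  (forall phi, inA E (radd E phi)) ->
  (forall s, size s = j.+1 -> inA E (c s)) ->
  (forall s x, size s = j.+2 -> bard rho j.+1 c s x = 0) ->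
  exists c', (forall s, inA E (c' s)) /\
    forall s x, size s = j.+1 -> bard rho j c' s x = c s x.
Proof.
move=> idemE cA dc; exists (fun s => radd E (bars rho c s)); split=> // s x Hs.
rewrite (bard_radd rhoP) -(cA s Hs x); apply: radd_ext => y.
have := bard_homotopy rhoM rho1 rhoP c y Hs.
by rewrite /bars dc ?(rho0 rhoP) ?addr0 //= Hs.
Qed.

Variables E0 E1 E2 D0 D1 : seq (K * G).
Hypothesis idemE0 : forall phi : G -> V, inA E0 (radd E0 phi).
Hypothesis idemE1 : forall phi : G -> V, inA E1 (radd E1 phi).
Hypothesis idemE2 : forall phi : G -> V, inA E2 (radd E2 phi).
Hypothesis cstA : forall v : V, inA E0 (fun=> v).
Hypothesis D0cst : forall (v : V) x, radd D0 (fun=> v) x = 0.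
Hypothesis D0A : forall phi : G -> V, inA E0 phi -> inA E1 (radd D0 phi).
Hypothesis D1A : forall phi : G -> V, inA E1 phi -> inA E2 (radd D1 phi).
Hypothesis D1D0 : forall phi : G -> V, inA E0 phi -> forall x, radd D1 (radd D0 phi) x = 0.
Hypothesis exact0 : forall phi : G -> V, inA E0 phi -> (forall x, radd D0 phi x = 0) ->
  exists v, phi =1 (fun=> v).
Hypothesis exact1 : forall phi : G -> V, inA E1 phi -> (forall x, radd D1 phi x = 0) ->
  exists2 psi, inA E0 psi & radd D0 psi =1 phi.
Hypothesis exact2 : forall phi : G -> V, inA E2 phi ->
  exists2 psi, inA E1 psi & radd D1 psi =1 phi.


(** Inhomogeneous cochains are arbitrary functions of s, so exactness of modules lifts to cochains
    by independent choices for each s, with 0 at other lengths. *)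
Lemma exact0_cochain j (c : seq G -> G -> V) :
  (forall s, size s = j -> inA E0 (c s)) ->
  (forall s x, size s = j -> radd D0 (c s) x = 0) ->
  exists f, forall s x, size s = j -> c s x = cst f s x.
Proof.
move=> cA dc; have /choice[f fP] : forall s, exists v, size s = j -> forall x, c s x = v.
  move=> s; have [Hs|/eqP nHs] := eqVneq (size s) j; last by exists 0 => /nHs.
  by have [v Hv] := exact0 (cA s Hs) (fun x => dc s x Hs); exists v.
by exists f => s x Hs; rewrite fP.
Qed.

Lemma exact1_cochain j (c : seq G -> G -> V) :
  (forall s, size s = j -> inA E1 (c s)) ->
  (forall s x, size s = j -> radd D1 (c s) x = 0) ->
  exists2 c', (forall s, size s = j -> inA E0 (c' s)) &
    forall s x, size s = j -> radd D0 (c' s) x = c s x.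
Proof.
move=> cA dc; have /choice[f fP] : forall s, exists psi,
    size s = j -> inA E0 psi /\ radd D0 psi =1 c s.
  move=> s; have [Hs|/eqP nHs] := eqVneq (size s) j; last by exists (fun=> 0) => /nHs.
  by have [v Hv] := exact1 (cA s Hs) (fun x => dc s x Hs); exists v.
by exists f => [s /fP[]//|s x /fP[_]].
Qed.

Lemma exact2_cochain j (c : seq G -> G -> V) :
  (forall s, size s = j -> inA E2 (c s)) ->
  exists2 c', (forall s, size s = j -> inA E1 (c' s)) &
    forall s x, size s = j -> radd D1 (c' s) x = c s x.
Proof.
move=> cA; have /choice[f fP] : forall s, exists psi,
    size s = j -> inA E1 psi /\ radd D1 psi =1 c s.
  move=> s; have [Hs|/eqP nHs] := eqVneq (size s) j; last by exists (fun=> 0) => /nHs.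
  by have [v Hv] := exact2 (cA s Hs); exists v.
by exists f => [s /fP[]//|s x /fP[_]].
Qed.

Lemma radd_bard j D (c c' : seq G -> G -> V) s x :
  (forall s x, size s = j -> radd D (c s) x = c' s x) -> size s = j.+1 ->
  radd D (bard rho j c s) x = bard rho j c' s x.
Proof. by move=> H Hs; rewrite -(bard_radd rhoP); apply: bard_ext. Qed.

(* Dimension shifting along 0 -> V -> A0 -> A1 -> A2 -> 0. *)
Lemma vcob_ge3 j f : vcoc rho j.+3 f -> vcob rho j.+3 f.
Proof.
move=> fP.
have [c [cA dc]] := acyclic_inA idemE0 (c := cst f) (fun _ _ => cstA _) fP.
have [|s x Hs|c1 [c1A dc1]] := @acyclic_inA E1 j.+1 (fun s => radd D0 (c s)) idemE1.
- by move=> s _; apply: D0A.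
- rewrite (bard_radd rhoP); apply: etrans (D0cst (f s) x).
  by apply: radd_ext => y; rewrite dc.
have [|s x Hs|c2 [c2A dc2]] := @acyclic_inA E2 j (fun s => radd D1 (c1 s)) idemE2.
- by move=> s _; apply: D1A.
- rewrite (bard_radd rhoP); apply: etrans (D1D0 (cA s) x).
  by apply: radd_ext => y; rewrite dc1.
(* The zigzag is unwound: [c2] lifts to [e], then [c1] minus the coboundary of [e] lifts to [c3],
   and [c] minus the coboundary of [c3] is a constant-valued primitive of [f]. *)
have [e eA de] := @exact2_cochain j c2 (fun s _ => c2A s).
have [|s x Hs|c3 c3A dc3] := @exact1_cochain j.+1 (fun s x => c1 s x + (-1) *: bard rho j e s x).
- by move=> s Hs; apply: inA_lin => //; apply: bard_inA Hs.
- by rewrite radd_lin (radd_bard _ de) // dc2 // scaleN1r subrr.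
have [|s x Hs|h Hh] := @exact0_cochain j.+2 (fun s x => c s x + (-1) *: bard rho j.+1 c3 s x).
- by move=> s Hs; apply: inA_lin => //; apply: bard_inA Hs.
- rewrite radd_lin (radd_bard _ dc3) //.
  by rewrite bard_lin // bard_bard // scaler0 addr0 dc1 // scaleN1r subrr.
exists h => s x Hs; rewrite -(bard_ext rho x Hh Hs) bard_lin // bard_bard //.
by rewrite scaler0 addr0 dc.
Qed.

Variables (I0 I1 I2 : {vspace V}) (d0 d1 : 'End(V)).
Hypothesis I0P : forall v, v \in I0 <-> lact rho E0 v = v.
Hypothesis I1P : forall v, v \in I1 <-> lact rho E1 v = v.
Hypothesis I2P : forall v, v \in I2 <-> lact rho E2 v = v.
Hypothesis d0P : forall v, d0 v = lact rho D0 v.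
Hypothesis d1P : forall v, d1 v = lact rho D1 v.

Lemma inI0 v : v \in I0 <-> inA E0 (inv_fun rho v).
Proof. by rewrite I0P inA_inv. Qed.

Lemma inI1 v : v \in I1 <-> inA E1 (inv_fun rho v).
Proof. by rewrite I1P inA_inv. Qed.

Lemma inI2 v : v \in I2 <-> inA E2 (inv_fun rho v).
Proof. by rewrite I2P inA_inv. Qed.

Lemma radd_inv0 v x : radd D0 (inv_fun rho v) x = inv_fun rho (d0 v) x.
Proof. by rewrite (radd_inv rhoM rhoP) d0P. Qed.

Lemma radd_inv1 v x : radd D1 (inv_fun rho v) x = inv_fun rho (d1 v) x.
Proof. by rewrite (radd_inv rhoM rhoP) d1P. Qed.

Lemma inv_fun_inj u v : inv_fun rho u =1 inv_fun rho v -> u = v.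
Proof. by move/(_ 1%g); rewrite /inv_fun !rho1. Qed.

Lemma inA_ext E phi psi : phi =1 psi -> inA E phi -> inA E psi.
Proof. by move=> e H x; rewrite -e -H; apply: radd_ext => y; rewrite e. Qed.

Lemma inv_funP (c : seq G -> G -> V) :
  (forall s x, size s = 1 -> bard rho 0 c s x = 0) ->
  c [::] =1 inv_fun rho (c [::] 1%g).
Proof.
move=> H; apply: invariant_fun => g x; rewrite -(H [:: g] x) //.
by rewrite /bard /= !big_ord0.
Qed.

Lemma bard_inv0 v s x : size s = 1 -> bard rho 0 (fun _ => inv_fun rho v) s x = 0.
Proof. by case: s => [|g []] //= _; apply: (bard_inv rhoM). Qed.

Lemma barH0 : barH rho 0 (\dim (I0 :&: lker d0) - \dim (0%VS : {vspace V})).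
Proof.
apply: (@barH_of_rel _ _ _ _ 0 _ _ (fun f u => f [::] = u)).
- exact: sub0v.
- move=> f fP; exists (f [::]) => //.
  have fE := @inv_funP (cst f) fP.
  rewrite memv_cap memv_ker; apply/andP; split.
    by apply/inI0; apply: inA_ext fE _; apply: cstA.
  apply/eqP/inv_fun_inj => x; rewrite -radd_inv0 -(radd_ext D0 x fE) D0cst.
  by rewrite /inv_fun (rho0 rhoP).
- move=> u; rewrite memv_cap memv_ker => /andP[/inI0 uA /eqP du].
  exists (fun=> u) => //; have [|v uv] := exact0 uA.
    by move=> x; rewrite radd_inv0 du /inv_fun (rho0 rhoP).
  move=> s x Hs; rewrite -(bard_inv0 u x Hs); apply: bard_ext => // s' y _.
  by rewrite /cst uv -(uv 1%g) /inv_fun rho1.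
- by move=> f f' u u' k <- <-.
- by move=> f u <-; rewrite memv0; split=> /eqP.
Qed.

(** The relation is a connecting map: f is the coboundary of some phi in A0, and D0 phi is then
    invariant, hence given by a vector v. *)
Lemma barH1 : barH rho 1 (\dim (I1 :&: lker d1) - \dim (d0 @: I0)).
Proof.
apply: (@barH_of_rel _ _ _ _ 1 _ _ (fun f v => exists phi : G -> V,
  [/\ inA E0 phi, forall s x, size s = 1 -> bard rho 0 (fun _ => phi) s x = f s &
      radd D0 phi =1 inv_fun rho v])).
- apply/subvP => _ /memv_imgP[u /inI0 uA ->]; rewrite memv_cap memv_ker.
  apply/andP; split; first by apply/inI1; apply: inA_ext (radd_inv0 u) _; apply: D0A.
  apply/eqP/inv_fun_inj => x; rewrite -radd_inv1.
  rewrite -(radd_ext D1 x (radd_inv0 u)) D1D0 //.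
  by rewrite /inv_fun (rho0 rhoP).
- move=> f fP.
  have [c [cA dc]] := acyclic_inA idemE0 (c := cst f) (fun _ _ => cstA _) fP.
  have dc0 s x : size s = 1 -> bard rho 0 (fun s => radd D0 (c s)) s x = 0.
    move=> Hs; rewrite (bard_radd rhoP); apply: etrans (D0cst (f s) x).
    by apply: radd_ext => y; rewrite dc.
  have e := inv_funP dc0; exists (radd D0 (c [::]) 1%g); last first.
    exists (c [::]); split=> // s x Hs; rewrite -[RHS]/(cst f s x) -dc //.
    by apply: bard_ext => // -[].
  rewrite memv_cap memv_ker; apply/andP; split.
    by apply/inI1; apply: inA_ext e _; apply: D0A.
  apply/eqP/inv_fun_inj => x; rewrite -radd_inv1 -(radd_ext D1 x e) D1D0 //.
  by rewrite /inv_fun (rho0 rhoP).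
- move=> v; rewrite memv_cap memv_ker => /andP[/inI1 vA /eqP dv].
  have [|phi phiA dphi] := exact1 vA.
    by move=> x; rewrite radd_inv1 dv /inv_fun (rho0 rhoP).
  have [|s x Hs|f Hf] := @exact0_cochain 1 (bard rho 0 (fun _ => phi)).
  - by move=> s; apply: bard_inA.
  - by rewrite (@radd_bard _ _ _ (fun _ => inv_fun rho v)) ?bard_inv0.
  exists f; last by exists phi; split.
  by move=> s x Hs; rewrite -(bard_ext rho x Hf Hs) bard_bard.
- move=> f f' u u' k [phi [H1 H2 H3]] [phi' [H1' H2' H3']].
  exists (fun x => phi x + k *: phi' x); split.
  + exact: inA_lin.
  + by move=> s x Hs; rewrite bard_lin // H2 // H2'.
  + by move=> x; rewrite radd_lin H3 H3' /inv_fun rhoP.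
- move=> f v [phi [phiA dphi Dphi]]; split=> [/memv_imgP[u /inI0 uA uv]|[h Hh]].
    have [||w Hw] := @exact0 (fun x => phi x + (-1) *: inv_fun rho u x).
    - exact: inA_lin.
    - by move=> x; rewrite radd_lin Dphi radd_inv0 uv scaleN1r subrr.
    exists (fun=> w) => s x Hs.
    rewrite -(dphi s x Hs) -[LHS]addr0 -[X in _ + X](scaler0 _ (-1)) -(bard_inv0 u x Hs).
    by rewrite -bard_lin //; apply: bard_ext => // s' y _; rewrite Hw.
  have dd s x : size s = 1 ->
      bard rho 0 (fun _ y => phi y + (-1) *: cst h [::] y) s x = 0.
    move=> Hs; rewrite (bard_lin rhoP 0 (fun _ => phi) (fun _ => cst h [::])).
    rewrite dphi // (Hh s x) // scaleN1r; apply/eqP; rewrite subr_eq0; apply/eqP.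
    by apply: bard_ext => // -[].
  have e := @inv_funP (fun _ y => phi y + (-1) *: cst h [::] y) dd.
  apply/memv_imgP; exists (phi 1%g + (-1) *: cst h [::] 1%g).
    apply/inI0; apply: inA_ext e _; apply: inA_lin => //; exact: cstA.
  apply: inv_fun_inj => x; rewrite -radd_inv0 -(radd_ext D0 x e) radd_lin.
  by rewrite D0cst scaler0 addr0 Dphi.
Qed.

(** The connecting map is iterated: f bounds c in A0, D0 c bounds phi in A1, and D1 phi is the
    invariant function of v. *)
Lemma barH2 : barH rho 2 (\dim I2 - \dim (d1 @: I1)).
Proof.
apply: (@barH_of_rel _ _ _ _ 2 _ _ (fun f v => exists (c : seq G -> G -> V) (phi : G -> V),
  [/\ forall s, size s = 1 -> inA E0 (c s), inA E1 phi,
      forall s x, size s = 2 -> bard rho 1 c s x = f s,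
      forall s x, size s = 1 -> radd D0 (c s) x = bard rho 0 (fun _ => phi) s x &
      radd D1 phi =1 inv_fun rho v])).
- apply/subvP => _ /memv_imgP[u /inI1 uA ->].
  by apply/inI2; apply: inA_ext (radd_inv1 u) _; apply: D1A.
- move=> f fP.
  have [c [cA dc]] := acyclic_inA idemE0 (c := cst f) (fun _ _ => cstA _) fP.
  have [|s x Hs|c1 [c1A dc1]] := @acyclic_inA E1 0 (fun s => radd D0 (c s)) idemE1.
  - by move=> s _; apply: D0A.
  - rewrite (bard_radd rhoP); apply: etrans (D0cst (f s) x).
    by apply: radd_ext => y; rewrite dc.
  have dd s x : size s = 1 -> bard rho 0 (fun s => radd D1 (c1 s)) s x = 0.
    move=> Hs; rewrite (bard_radd rhoP) -(D1D0 (cA s) x).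
    by apply: radd_ext => y; rewrite dc1.
  have e := inv_funP dd; exists (radd D1 (c1 [::]) 1%g).
    by apply/inI2; apply: inA_ext e _; apply: D1A.
  exists c, (c1 [::]); split=> // s x Hs.
  by rewrite -dc1 //; apply: bard_ext => // -[].
- move=> v /inI2 vA; have [phi phiA dphi] := exact2 vA.
  have [|s x Hs|c cA dc] := @exact1_cochain 1 (bard rho 0 (fun _ => phi)).
  - by move=> s; apply: bard_inA.
  - by rewrite (@radd_bard _ _ _ (fun _ => inv_fun rho v)) ?bard_inv0.
  have [|s x Hs|f Hf] := @exact0_cochain 2 (bard rho 1 c).
  - by move=> s; apply: bard_inA.
  - by rewrite (radd_bard _ dc) // bard_bard.
  exists f; last by exists c, phi; split.
  by move=> s x Hs; rewrite -(bard_ext rho x Hf Hs) bard_bard.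
- move=> f f' u u' k [c [phi [H1 H2 H3 H4 H5]]] [c' [phi' [H1' H2' H3' H4' H5']]].
  exists (fun s x => c s x + k *: c' s x), (fun x => phi x + k *: phi' x); split.
  + by move=> s Hs; apply: inA_lin; auto.
  + exact: inA_lin.
  + by move=> s x Hs; rewrite bard_lin // H3 // H3'.
  + by move=> s x Hs; rewrite bard_lin // radd_lin H4 // H4'.
  + by move=> x; rewrite radd_lin H5 H5' /inv_fun rhoP.
- move=> f v [c [phi [cA phiA dc Dc Dphi]]]; split=> [/memv_imgP[u /inI1 uA uv]|[h Hh]].
    have [||chi chiA dchi] := @exact1 (fun x => phi x + (-1) *: inv_fun rho u x).
    - exact: inA_lin.
    - by move=> x; rewrite radd_lin Dphi radd_inv1 uv scaleN1r subrr.
    have [|s x Hs|h Hh] := @exact0_cochain 1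
        (fun s x => c s x + (-1) *: bard rho 0 (fun _ => chi) s x).
    - by move=> s Hs; apply: inA_lin; [exact: cA|apply: bard_inA Hs].
    - rewrite radd_lin Dc // (@radd_bard _ _ _ (fun _ y => phi y + (-1) *: inv_fun rho u y)) //.
      rewrite (bard_lin rhoP 0 (fun _ => phi) (fun _ => inv_fun rho u)).
      by rewrite bard_inv0 // scaler0 addr0 scaleN1r subrr.
    exists h => s x Hs; rewrite -(bard_ext rho x Hh Hs) bard_lin // bard_bard //.
    by rewrite scaler0 addr0 dc.
  have [|s x Hs|chi [chiA dchi]] :=
      @acyclic_inA E0 0 (fun s y => c s y + (-1) *: cst h s y) idemE0.
  - by move=> s Hs; apply: inA_lin; [exact: cA|exact: cstA].
  - by rewrite bard_lin // dc // -Hh // scaleN1r subrr.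
  have dd s x : size s = 1 ->
      bard rho 0 (fun s y => phi y + (-1) *: radd D0 (chi s) y) s x = 0.
    move=> Hs; rewrite (bard_lin rhoP 0 (fun _ => phi)) (bard_radd rhoP).
    rewrite -Dc // (radd_ext D0 x (fun y => dchi s y Hs)) radd_lin D0cst.
    by rewrite scaler0 addr0 scaleN1r subrr.
  have e := @inv_funP _ dd.
  apply/memv_imgP; exists (phi 1%g + (-1) *: radd D0 (chi [::]) 1%g).
    by apply/inI1; apply: inA_ext e _; apply: inA_lin => //; apply: D0A.
  apply: inv_fun_inj => x; rewrite -radd_inv1 -(radd_ext D1 x e) radd_lin.
  by rewrite D1D0 // scaler0 addr0 Dphi.
Qed.

Lemma barH_euler : exists d : nat -> nat,
  [/\ forall j, barH rho j (d j), forall j, (2 < j)%N -> d j = 0%N &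
      (d 0%N)%:Z - (d 1%N)%:Z + (d 2%N)%:Z = (\dim I0)%:Z - (\dim I1)%:Z + (\dim I2)%:Z].
Proof.
exists (fun j => match j with
  | 0 => \dim (I0 :&: lker d0) - \dim (0%VS : {vspace V})
  | 1 => \dim (I1 :&: lker d1) - \dim (d0 @: I0)
  | 2 => \dim I2 - \dim (d1 @: I1)
  | _ => 0
  end)%N; split.
- move=> [|[|[|j]]]; [exact: barH0|exact: barH1|exact: barH2|].
  by apply: barH_vanish => f; apply: vcob_ge3.
- by move=> [|[|[]]].
(* These inequalities make the truncated subtractions genuine, after which rank-nullity cancels the
   ranks of [d0] and [d1]. *)
have s0 : (\dim (d0 @: I0) <= \dim (I1 :&: lker d1))%N.
  apply: dimvS; apply/subvP => _ /memv_imgP[u /inI0 uA ->]; rewrite memv_cap memv_ker.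
  apply/andP; split; first by apply/inI1; apply: inA_ext (radd_inv0 u) _; apply: D0A.
  apply/eqP/inv_fun_inj => x; rewrite -radd_inv1.
  rewrite -(radd_ext D1 x (radd_inv0 u)) D1D0 //.
  by rewrite /inv_fun (rho0 rhoP).
have s1 : (\dim (d1 @: I1) <= \dim I2)%N.
  apply: dimvS; apply/subvP => _ /memv_imgP[u /inI1 uA ->].
  by apply/inI2; apply: inA_ext (radd_inv1 u) _; apply: D1A.
rewrite dimv0; have := limg_ker_dim d0 I0; have := limg_ker_dim d1 I1 => /=; lia.
Qed.
End AcyclicResolution.

(** * Exactness for the dual complex of a tessellation *)

(** Six is already the value at (1,1,1,1), and the second symmetric function strictly increases in
    each positive variable. *)
Lemma sym2_eq6 (p q u v : int) : 1 <= p -> 1 <= q -> 1 <= u -> 1 <= v ->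
  p * q + p * u + p * v + q * u + q * v + u * v = 6 ->
  [/\ p = 1, q = 1, u = 1 & v = 1].
Proof.
rewrite -(subr_ge0 1 p) -(subr_ge0 1 q) -(subr_ge0 1 u) -(subr_ge0 1 v).
move=> Hp Hq Hu Hv E.
have := mulr_ge0 Hp Hq; have := mulr_ge0 Hp Hu; have := mulr_ge0 Hp Hv.
have := mulr_ge0 Hq Hu; have := mulr_ge0 Hq Hv; have := mulr_ge0 Hu Hv.
rewrite !mulrBl !mulrBr !mul1r !mulr1 => *; split; lia.
Qed.

(* An element x of G stands for the flag (tetrahedron, face, edge) image of a base flag;
   right multiplication by a, b, t changes the edge, the face and the tetrahedron, and
   m0, ..., m3 are the norms of the vertices, the face being opposite to the last one. *)
Section TessellationExactness.
Variables (K : fieldType) (V : lmodType K) (G : groupType).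
Hypothesis charK : forall n, n.+1%:R != 0 :> K.
Variables (a b t z : G) (m0 m1 m2 m3 : G -> int).
Hypothesis zC : forall x, (x * z = z * x)%g.
Hypothesis z6 : (z ^+ 6 = 1)%g.
Hypothesis a3 : (a ^+ 3 = 1)%g.
Hypothesis b2 : (b * b = z ^+ 3)%g.
Hypothesis t2 : (t * t = 1)%g.
Hypothesis at2 : (a * t = t * a ^+ 2)%g.
Hypothesis r6 : ((t * b) ^+ 6 = 1)%g.
Hypothesis Ma : forall x, [/\ m0 (x * a)%g = m1 x, m1 (x * a)%g = m2 x,
  m2 (x * a)%g = m0 x & m3 (x * a)%g = m3 x].
Hypothesis Mb : forall x, [/\ m0 (x * b)%g = m1 x, m1 (x * b)%g = m0 x,
  m2 (x * b)%g = m3 x & m3 (x * b)%g = m2 x].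
Hypothesis Mt : forall x, [/\ m0 (x * t)%g = m1 x, m1 (x * t)%g = m0 x,
  m2 (x * t)%g = m2 x & m3 (x * t)%g = m0 x + m1 x + m2 x - m3 x].
Hypothesis Mz : forall x, [/\ m0 (x * z)%g = m0 x, m1 (x * z)%g = m1 x,
  m2 (x * z)%g = m2 x & m3 (x * z)%g = m3 x].
Hypothesis Mpos : forall x, [/\ 0 < m0 x, 0 < m1 x, 0 < m2 x & 0 < m3 x].
Hypothesis Msq : forall x, m0 x * m0 x + m1 x * m1 x + m2 x * m2 x + m3 x * m3 x
  - (m0 x * m1 x + m0 x * m2 x + m0 x * m3 x + m1 x * m2 x + m1 x * m3 x + m2 x * m3 x) = -2%:Z.

(** [La] is the part keeping tetrahedron and face. Modulo scalars, [L0] is A_4 written as the two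
    double cosets of its cyclic subgroup of order 3, of sizes 3 and 9. *)
Definition La : seq G := [seq (a ^+ i * z ^+ k)%g | i <- iota 0 3, k <- iota 0 6].
Definition Lb : seq G := [seq (a ^+ p.1 * b * a ^+ p.2 * z ^+ k)%g |
  p <- [seq (i, l) | i <- iota 0 3, l <- iota 0 3], k <- iota 0 6].
Definition L0 : seq G := La ++ Lb.
Hypothesis L0perm : forall g, g \in [:: a; b; z] -> perm_eq [seq (g * h)%g | h <- L0] L0.
Hypothesis M1 : forall x, m0 x = 1 -> m1 x = 1 -> m2 x = 1 -> m3 x = 1 -> x \in L0.

(** Crossing the face by [t] and passing to the other face at the same edge by [b] is one step
    around the edge. *)
Definition hexrot := (t * b)%g.
Definition desc (x : G) : bool := m0 x + m1 x + m2 x < 2 * m3 x.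
Definition height x : nat := absz (m0 x + m1 x + m2 x + m3 x).

Lemma Mr x : [/\ m0 (x * hexrot)%g = m0 x, m1 (x * hexrot)%g = m1 x,
  m2 (x * hexrot)%g = m0 x + m1 x + m2 x - m3 x & m3 (x * hexrot)%g = m2 x].
Proof.
rewrite /hexrot mulgA; have [-> -> -> ->] := Mb (x * t)%g.
by have [-> -> -> ->] := Mt x; split=> //; ring.
Qed.

(** Equality would turn [Msq] into a multiple of 3 being equal to -8. Hence no face separates
    tetrahedra of equal height. *)
Lemma desc_neutral x : m0 x + m1 x + m2 x != 2 * m3 x.
Proof.
apply/eqP => e; have := Msq x; set p := m0 x in e *; set q := m1 x in e *.
set u := m2 x in e *; set v := m3 x in e *; move=> H.
have : 3 * (p * p + q * q + u * u - 2 * (p * q + p * u + q * u)) = - 8.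
  have -> : (-8 : int) = 4 * (-2) by [].
  rewrite -H; have -> : p = 2 * v - q - u by lia.
  ring.
lia.
Qed.

Lemma desc_a x : desc (x * a)%g = desc x.
Proof. by rewrite /desc; have [-> -> -> ->] := Ma x; rewrite addrC addrA. Qed.

Lemma desc_z x : desc (x * z)%g = desc x.
Proof. by rewrite /desc; have [-> -> -> ->] := Mz x. Qed.

Lemma desc_t x : desc (x * t)%g = ~~ desc x.
Proof.
rewrite /desc; have [-> -> -> ->] := Mt x; have := desc_neutral x; lia.
Qed.

Lemma height_a x : height (x * a)%g = height x.
Proof. by rewrite /height; have [-> -> -> ->] := Ma x; congr absz; ring. Qed.

Lemma height_b x : height (x * b)%g = height x.
Proof. by rewrite /height; have [-> -> -> ->] := Mb x; congr absz; ring. Qed.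

Lemma height_z x : height (x * z)%g = height x.
Proof. by rewrite /height; have [-> -> -> ->] := Mz x. Qed.

Lemma height_t x : desc x -> (height (x * t)%g < height x)%N.
Proof.
rewrite /height /desc; have [-> -> -> ->] := Mt x; have [] := Mpos x.
have [_ _ _] := Mpos (x * t)%g; have [_ _ _ ->] := Mt x; lia.
Qed.

Lemma height_gt0 x : (0 < height x)%N.
Proof. by rewrite /height; have [] := Mpos x; lia. Qed.

(** The four flags show the four faces, opposite to the vertices of norms m3, m2, m0, m1. By
    [desc_neutral] all four inequalities are strict. *)
Lemma no_desc x : ~~ desc x -> ~~ desc (x * b)%g -> ~~ desc (x * a * b)%g ->
  ~~ desc (x * a * a * b)%g -> x \in L0.
Proof.
rewrite /desc.
have [-> -> -> ->] := Mb x; have [-> -> -> ->] := Mb (x * a)%g.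
have [-> -> -> ->] := Mb (x * a * a)%g; have [-> -> -> ->] := Ma (x * a)%g.
have [-> -> -> ->] := Ma x.
have N0 := desc_neutral x; have := desc_neutral (x * b)%g.
have := desc_neutral (x * a * b)%g; have := desc_neutral (x * a * a * b)%g.
have [-> -> -> ->] := Mb x; have [-> -> -> ->] := Mb (x * a)%g.
have [-> -> -> ->] := Mb (x * a * a)%g; have [-> -> -> ->] := Ma (x * a)%g.
have [-> -> -> ->] := Ma x => N1 N2 N3 H0 H1 H2 H3.
have Q := Msq x; have [P0 P1 P2 P3] := Mpos x; have := M1 (x := x).
move: (m0 x) (m1 x) (m2 x) (m3 x) N0 N1 N2 N3 H0 H1 H2 H3 Q P0 P1 P2 P3.
move=> p q u v N0 N1 N2 N3 H0 H1 H2 H3 Q P0 P1 P2 P3 H.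
(* the excesses n_i = S - 3 m_i are positive and their second symmetric function is 6 *)
pose S := p + q + u + v; pose n0 := S - 3 * p; pose n1 := S - 3 * q.
pose n2 := S - 3 * u; pose n3 := S - 3 * v.
have [e0 e1 e2 e3] : [/\ 1 <= n0, 1 <= n1, 1 <= n2 & 1 <= n3].
  by rewrite /n0 /n1 /n2 /n3 /S; split; lia.
have E : n0 * n1 + n0 * n2 + n0 * n3 + n1 * n2 + n1 * n3 + n2 * n3 = 6.
  have -> : (6 : int) = (-3) * (-2) by [].
  by rewrite -Q /n0 /n1 /n2 /n3 /S; ring.
have [f0 f1 f2 f3] : [/\ n0 = 1, n1 = 1, n2 = 1 & n3 = 1].
    by clearbody n0 n1 n2 n3; exact: sym2_eq6.
by apply: H; move: f0 f1 f2 f3; rewrite /n0 /n1 /n2 /n3 /S; lia.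
Qed.

(** The signs are orientations of dual cells: [t] reverses the dual edge across a face, and both [b]
    and [t] reverse the hexagon around an edge. *)
Definition A0 (phi : G -> V) := [/\ forall x, phi (x * a)%g = phi x,
  forall x, phi (x * b)%g = phi x & forall x, phi (x * z)%g = phi x].
Definition A1 (psi : G -> V) := [/\ forall x, psi (x * a)%g = psi x,
  forall x, psi (x * t)%g = - psi x & forall x, psi (x * z)%g = psi x].
Definition A2 (theta : G -> V) := [/\ forall x, theta (x * b)%g = - theta x,
  forall x, theta (x * t)%g = - theta x & forall x, theta (x * z)%g = theta x].
Definition D0 (phi : G -> V) x := phi (x * t)%g - phi x.
Definition D1 (psi : G -> V) x := \sum_(k < 6) psi (x * hexrot ^+ k)%g.

Lemma inv_pow (T : Type) (phi : G -> T) g k x :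
  (forall y, phi (y * g)%g = phi y) -> phi (x * g ^+ k)%g = phi x.
Proof.
by move=> H; elim: k x => [|k IH] x; rewrite ?mulg1 // expgSr mulgA H IH.
Qed.

Lemma L0_ind (P : G -> Prop) x : P x -> (forall y, P y -> P (y * a)%g) ->
  (forall y, P y -> P (y * b)%g) -> (forall y, P y -> P (y * z)%g) ->
  forall h, h \in L0 -> P (x * h)%g.
Proof.
move=> Px Pa Pb Pz.
have pw g : (forall y, P y -> P (y * g)%g) -> forall k y, P y -> P (y * g ^+ k)%g.
  by move=> H; elim=> [|k IH] y Py; rewrite ?mulg1 // expgSr mulgA; apply/H/IH.
move=> h; rewrite mem_cat => /orP[] /allpairsP[[i k] [_ _ ->]] /=; rewrite !mulgA.
  by apply: (pw _ Pz); apply: (pw _ Pa).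
by apply: (pw _ Pz); apply: (pw _ Pa); apply: Pb; apply: (pw _ Pa).
Qed.

Lemma A0_L0 phi h x : A0 phi -> h \in L0 -> phi (x * h)%g = phi x.
Proof.
case=> Ha Hb Hz; apply: (L0_ind (P := fun y => phi y = phi x)) => // y Hy.
- by rewrite Ha.
- by rewrite Hb.
- by rewrite Hz.
Qed.

Lemma height_L0 h x : h \in L0 -> height (x * h)%g = height x.
Proof.
apply: (L0_ind (P := fun y => height y = height x)) => // y Hy.
- by rewrite height_a.
- by rewrite height_b.
- by rewrite height_z.
Qed.

Lemma L0_1 : 1%g \in L0.
Proof.
rewrite mem_cat; apply/orP; left; apply/allpairsP; exists (0%N, 0%N); split=> //=.
by rewrite mulg1.
Qed.

(** Crossing a descending face keeps phi and lowers the height, until [no_desc] puts x into the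
    stabilizer of the base tetrahedron. *)
Lemma A0_exact phi : A0 phi -> (forall x, D0 phi x = 0) -> forall x, phi x = phi 1%g.
Proof.
move=> phiA dphi x; have [n] := ubnP (height x); elim: n x => // n IH x.
have Dt y : phi (y * t)%g = phi y by apply/eqP; rewrite -subr_eq0 -[_ - _]/(D0 phi y) dphi.
have step y : phi y = phi x -> height y = height x -> desc y -> (height x < n.+1)%N ->
    phi x = phi 1%g.
  move=> e1 e2 dy lx; rewrite -e1 -Dt; apply: IH.
  by have := height_t dy; rewrite e2; lia.
have [dx|nx] := boolP (desc x); first exact: (step x).
have [Ha Hb Hz] := phiA.
have [dx|nx1] := boolP (desc (x * b)%g).
  by apply: step dx; rewrite ?Hb ?height_b.
have [dx|nx2] := boolP (desc (x * a * b)%g).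
  by apply: step dx; rewrite ?Hb ?Ha ?height_b ?height_a.
have [dx|nx3] := boolP (desc (x * a * a * b)%g).
  by apply: step dx; rewrite ?Hb ?Ha ?height_b ?height_a.
by move=> _; rewrite -[x]mul1g; apply: A0_L0 => //; apply: no_desc.
Qed.

Lemma b_inv : (b^-1 = b * z ^+ 3)%g.
Proof. by apply/mulg1_eq; rewrite mulgA b2 -expgnDr z6. Qed.

Lemma t_inv : (t^-1 = t)%g.
Proof. exact/mulg1_eq. Qed.

Lemma zXC k x : (x * z ^+ k = z ^+ k * x)%g.
Proof. by elim: k => [|k IH]; rewrite ?mulg1 ?mul1g // expgS mulgA zC -mulgA IH mulgA. Qed.

(** Dihedral relation: [t] and [b] are involutions modulo scalars, and each inversion of [b] costs a
    central factor z^3. *)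
Lemma tr k : (t * hexrot ^+ k = hexrot ^- k * t * (z ^+ 3) ^+ k)%g.
Proof.
have z33 : (z ^+ 3 * z ^+ 3 = 1)%g by rewrite -expgnDr z6.
move: z33 b_inv (zXC 3); move: (z ^+ 3)%g => z3 z33 bi z3C.
have tr1 : (t * hexrot = hexrot^-1 * t * z3)%g.
  rewrite /hexrot invgM bi t_inv !mulgA t2 mul1g -[(_ * t * t)%g]mulgA t2 mulg1.
  by rewrite -mulgA z33 mulg1.
move: tr1; move: hexrot => q tr1.
have z3X n : (z3 ^+ n * q = q * z3 ^+ n)%g by apply: commute_sym; apply: commuteX; apply: z3C.
elim: k => [|k IH]; first by rewrite invg1 mul1g !mulg1.
rewrite expgSr mulgA IH -mulgA z3X mulgA -[(_ * t * q)%g]mulgA tr1.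
have -> : (q ^+ k * q = q * q ^+ k)%g by rewrite -expgSr expgS.
by rewrite invgM [(z3 ^+ k.+1)%g]expgS !mulgA.
Qed.

Lemma A1_flip psi k x : A1 psi -> (k <= 6)%N ->
  psi (x * t * hexrot ^+ k)%g = - psi (x * hexrot ^+ (6 - k))%g.
Proof.
case=> _ Ht Hz le6; rewrite -mulgA tr !mulgA inv_pow; last by move=> y; apply: inv_pow.
rewrite Ht.
by rewrite expgnFr // [(hexrot ^+ 6)%g]r6 div1g.
Qed.

Lemma D1_r psi x : D1 psi (x * hexrot)%g = D1 psi x.
Proof.
rewrite /D1 big_ord_recr [RHS]big_ord_recl /= addrC expg0 mulg1.
rewrite -mulgA -expgS [(hexrot ^+ 6)%g]r6 mulg1; congr (_ + _).
by apply: eq_bigr => i _; rewrite -mulgA -expgS.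
Qed.

Lemma xrb x : (x * hexrot = x * t * b)%g. Proof. by rewrite mulgA. Qed.

Lemma D1_A psi : A1 psi -> A2 (D1 psi).
Proof.
move=> psiA.
have Ht x : D1 psi (x * t)%g = - D1 psi x.
  rewrite /D1 big_ord_recl expg0 mulg1 [X in - X]big_ord_recl expg0 mulg1 opprD.
  case: (psiA) => _ -> _; congr (_ + _).
  rewrite -sumrN (reindex_inj rev_ord_inj) /=; apply: eq_bigr => i _.
  rewrite A1_flip //; last by rewrite /bump; lia.
  by congr (- psi (_ * _ ^+ _)%g); rewrite /bump; have := ltn_ord i; lia.
split=> // x; last first.
  by apply: eq_bigr => i _; rewrite -mulgA -zC mulgA; case: psiA => _ _ ->.
by rewrite -Ht -[RHS]D1_r /hexrot !mulgA -[(x * t * t)%g]mulgA t2 mulg1.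
Qed.

Lemma D0_A phi : A0 phi -> A1 (D0 phi).
Proof.
case=> Ha Hb Hz; split=> x; rewrite /D0.
- by rewrite -[(x * a * t)%g]mulgA at2 mulgA Ha inv_pow.
- by rewrite -[(x * t * t)%g]mulgA t2 mulg1 opprB.
- by rewrite -[(x * z * t)%g]mulgA -zC mulgA !Hz.
Qed.

Lemma D1_D0 phi x : A0 phi -> D1 (D0 phi) x = 0.
Proof.
case=> Ha Hb Hz; rewrite /D1 /D0.
have e i : phi (x * hexrot ^+ i * t)%g = phi (x * hexrot ^+ i.+1)%g.
  by rewrite -Hb expgSr -!mulgA.
under eq_bigr => i _ do rewrite e.
rewrite -(big_mkord xpredT (fun i => phi (x * hexrot ^+ i.+1)%g - phi (x * hexrot ^+ i)%g)).
by rewrite telescope_sumr // [(hexrot ^+ 6)%g]r6 expg0 subrr.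
Qed.

Lemma r5 : (hexrot ^+ 5 = b * t * z ^+ 3)%g.
Proof.
have /mulg1_eq <- : (hexrot * hexrot ^+ 5 = 1)%g by rewrite -expgS [LHS]r6.
by rewrite /hexrot invgM b_inv t_inv -mulgA -zXC mulgA.
Qed.

(** Around the edge m0 and m1 stay fixed while (m3, m2) slides along the recurrence c_(k+1) = m0 +
    m1 + c_k - c_(k-1), of period six; everything becomes linear in the norms of x. *)
Lemma hexagon_height x k : desc x -> desc (x * b)%g -> (0 < k < 6)%N ->
  (height (x * hexrot ^+ k)%g < height x)%N.
Proof.
have R0 y : m0 (y * hexrot)%g = m0 y by have [] := Mr y.
have R1 y : m1 (y * hexrot)%g = m1 y by have [] := Mr y.
have R2 y : m2 (y * hexrot)%g = m0 y + m1 y + m2 y - m3 y by have [] := Mr y.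
have R3 y : m3 (y * hexrot)%g = m2 y by have [] := Mr y.
have P k' : (0 < m0 (x * hexrot ^+ k')%g) && (0 < m1 (x * hexrot ^+ k')%g) &&
    (0 < m2 (x * hexrot ^+ k')%g) && (0 < m3 (x * hexrot ^+ k')%g).
  by have [-> -> -> ->] := Mpos (x * hexrot ^+ k')%g.
have := P 0%N; have := P 1%N; have := P 2%N; have := P 3%N; have := P 4%N; have := P 5%N.
rewrite /desc /height; have [-> -> -> ->] := Mb x.
move: R0 R1 R2 R3 {P}; move: hexrot => q R0 R1 R2 R3.
case: k => [|[|[|[|[|[|k]]]]]] //;
  rewrite !expgSr !expg0 mul1g !mulgA !mulg1 ?(R3, R2, R1, R0); lia.
Qed.

(** * Primitives of closed 1-cochains *)

Section Exact1.
Variable psi : G -> V.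
Hypothesis psiA : A1 psi.
Hypothesis dpsi : forall x, D1 psi x = 0.

(* By the hexagon relations all descending faces of a tetrahedron prescribe the same
   value; averaging over them makes invariance under the stabilizer automatic. *)
Fixpoint primitive1 n x : V :=
  if n is n'.+1 then
    (count (fun h => desc (x * h)%g) L0)%:R^-1 *:
    \sum_(h <- L0 | desc (x * h)%g) (primitive1 n' (x * h * t)%g - psi (x * h)%g)
  else 0.

Definition primitive x := primitive1 (height x) x.

Lemma primitive1_stable n x : (height x <= n)%N -> primitive1 n x = primitive x.
Proof.
suff H m : (height x <= m)%N -> (height x <= n)%N -> primitive1 n x = primitive1 m x.
  by move=> le; apply: H.
elim: n x m => [|n IH] x [|m]; rewrite ?leqn0; try by have := height_gt0 x; lia.
move=> lm ln /=; congr (_ *: _); rewrite big_seq_cond [RHS]big_seq_cond.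
apply: eq_bigr => h /andP[hL dh]; have := height_t dh; rewrite (height_L0 x hL) => lt.
by rewrite (IH _ m) //; lia.
Qed.

Lemma primitiveE x : primitive x = (count (fun h => desc (x * h)%g) L0)%:R^-1 *:
    \sum_(h <- L0 | desc (x * h)%g) (primitive (x * h * t)%g - psi (x * h)%g).
Proof.
rewrite /primitive; case E : (height x) => [|n]; first by have := height_gt0 x; lia.
rewrite /=; congr (_ *: _); rewrite big_seq_cond [RHS]big_seq_cond.
apply: eq_bigr => h /andP[hL dh]; have := height_t dh; rewrite (height_L0 x hL) => lt.
by rewrite primitive1_stable //; lia.
Qed.

Lemma primitive_A0 : A0 primitive.
Proof.
have H g x : g \in [:: a; b; z] -> primitive (x * g)%g = primitive x.
  move=> /L0perm; rewrite primitiveE [RHS]primitiveE; move: L0 => L pL.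
  rewrite -[in RHS](perm_big _ pL) -[in RHS](permP pL) count_map big_map /=.
  congr (_%:R^-1 *: _); first by apply: eq_count => h /=; rewrite mulgA.
  by apply: eq_big => h; rewrite mulgA.
by split=> x; apply: H; rewrite !inE eqxx ?orbT.
Qed.

(** At the top of a hexagon, the four middle terms of D1 psi = 0 join lower tetrahedra, where psi is
    already a difference of [primitive]. They telescope, leaving the two terms of the faces at x. *)
Lemma hexagon_primitive x :
  desc x -> desc (x * b)%g ->
  (forall y, (height y < height x)%N -> desc y -> psi y = D0 primitive y) ->
  primitive (x * b * t)%g - psi (x * b)%g = primitive (x * t)%g - psi x.
Proof.
move=> dx dxb IH; have [Ha Hb Hz] := primitive_A0.
have edge y : (height y < height x)%N -> (height (y * t)%g < height x)%N ->
    psi y = D0 primitive y.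
  move=> ly lyt; have [dy|ndy] := boolP (desc y); first exact: IH.
  have := IH _ lyt; rewrite desc_t ndy => /(_ isT).
  have [_ -> _] := psiA; have [_ -> _] := D0_A primitive_A0.
  exact: oppr_inj.
have := dpsi x; rewrite /D1 big_ord_recl big_ord_recr /= expg0 mulg1.
rewrite (eq_bigr (fun i : 'I_4 => primitive (x * hexrot ^+ i.+2)%g - primitive (x * hexrot ^+ i.+1)%g)); last first.
  move=> i _; rewrite edge.
  - by rewrite /D0 -Hb -!mulgA -expgSr.
  - by apply: hexagon_height => //; have := ltn_ord i; rewrite /bump; lia.
  - rewrite -height_b -!mulgA -expgSr; apply: hexagon_height => //.
    by have := ltn_ord i; rewrite /bump; lia.
rewrite -(big_mkord xpredT (fun i => primitive (x * hexrot ^+ i.+2)%g - primitive (x * hexrot ^+ i.+1)%g)).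
have x5 : (x * hexrot ^+ 5 = x * b * t * z ^+ 3)%g by rewrite r5 !mulgA.
rewrite telescope_sumr // expg1 (_ : bump 0 4 = 5%N) // x5 xrb.
have Az : forall y, psi (y * z)%g = psi y by case: psiA.
rewrite (inv_pow (phi := primitive)) // (inv_pow (phi := psi)) // Hb.
case: psiA => _ -> _ e.
apply/eqP; rewrite -subr_eq0 -e opprB [X in X == _]addrCA.
by rewrite [X in _ + X == _]addrAC.
Qed.

Lemma primitiveP x : desc x -> psi x = D0 primitive x.
Proof.
have [n] := ubnP (height x); elim: n x => // n IH x lx dx.
have [Ha Hb Hz] := primitive_A0; have [Pa Pt Pz] := psiA.
pose val y := primitive (y * t)%g - psi y.
have val_a i y : val (y * a ^+ i)%g = val y.
  apply: inv_pow => {}y; rewrite /val Pa -[(y * a * t)%g]mulgA at2 mulgA inv_pow //.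
have val_z k y : val (y * z ^+ k)%g = val y.
  by apply: inv_pow => {}y; rewrite /val Pz -[(y * z * t)%g]mulgA -zC mulgA Hz.
have desc_az i k y : desc (y * a ^+ i * z ^+ k)%g = desc y.
  by rewrite inv_pow ?inv_pow //; [apply: desc_a|apply: desc_z].
have height_a3 i : height (x * a ^+ i)%g = height x by apply/inv_pow/height_a.
(* Elements of [La] keep the face. The others lead to the face across the edge selected by a^i,
   where [hexagon_primitive] compares the two values. *)
have H h : h \in L0 -> desc (x * h)%g -> val (x * h)%g = val x.
  rewrite mem_cat => /orP[] /allpairsP[[i k] [_ _ ->]] /=; rewrite !mulgA.
    by rewrite val_z val_a.
  rewrite desc_az val_z val_a => dxb; rewrite -(val_a i.1 x).
  apply: hexagon_primitive => //.
    by rewrite inv_pow //; apply: desc_a.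
  by move=> y; rewrite height_a3 => ly; apply: IH; lia.
suff e : primitive x = val x by rewrite /D0 e /val opprB [RHS]addrC subrK.
rewrite primitiveE big_seq_cond (eq_bigr (fun=> val x)); last first.
  by move=> h /andP[hL dh]; rewrite -(H h).
rewrite -big_seq_cond big_const_seq iter_addr_0 -scaler_nat scalerA mulVf ?scale1r //.
have : has (fun h => desc (x * h)%g) L0.
  by apply/hasP; exists 1%g; [exact: L0_1|rewrite mulg1].
by rewrite has_count; case: count => // m _; apply: charK.
Qed.

Lemma A1_exact : exists2 phi, A0 phi & D0 phi =1 psi.
Proof.
exists primitive; first exact: primitive_A0.
move=> x; have [dx|ndx] := boolP (desc x); first by rewrite primitiveP.
have := @primitiveP (x * t)%g; rewrite desc_t ndx => /(_ isT).
have [_ -> _] := psiA; have [_ -> _] := D0_A primitive_A0.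
by move/oppr_inj.
Qed.
End Exact1.

(** A face opposite to m_i descends when 3 m_i exceeds the sum of all norms. Three such inequalities
    add up to a negative fourth norm. *)
Lemma desc_three x : desc x -> desc (x * b)%g ->
  ~~ desc (x * a * b)%g /\ ~~ desc (x * a * a * b)%g.
Proof.
rewrite /desc; have [-> -> -> ->] := Mb x; have [-> -> -> ->] := Mb (x * a)%g.
have [-> -> -> ->] := Mb (x * a * a)%g; have [-> -> -> ->] := Ma (x * a)%g.
by have [-> -> -> ->] := Ma x; have [] := Mpos x; lia.
Qed.

(** With u = m3 - m0 - m1 and v = m2 - m0 - m1, [hexrot] acts as the order six rotation (u, v) ->
    (v, v - u). The top condition 2u > v, 2v > u is a sector of one sixth of the plane, whose
    boundary rays are excluded by [desc_neutral]. *)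
Lemma hexagon_top x : exists k, desc (x * hexrot ^+ k)%g /\ desc (x * hexrot ^+ k * b)%g.
Proof.
suff H : [|| desc x && desc (x * b)%g,
    desc (x * hexrot)%g && desc (x * hexrot * b)%g,
    desc (x * hexrot * hexrot)%g && desc (x * hexrot * hexrot * b)%g,
    desc (x * hexrot * hexrot * hexrot)%g && desc (x * hexrot * hexrot * hexrot * b)%g,
    desc (x * hexrot * hexrot * hexrot * hexrot)%g && desc (x * hexrot * hexrot * hexrot * hexrot * b)%g |
    desc (x * hexrot * hexrot * hexrot * hexrot * hexrot)%g && desc (x * hexrot * hexrot * hexrot * hexrot * hexrot * b)%g].
  have {}H : exists2 k, (k < 6)%N & desc (x * hexrot ^+ k)%g && desc (x * hexrot ^+ k * b)%g.
    move: H; rewrite -!(mulgA _ hexrot hexrot).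
    case/or4P => [H|H|H|/or3P[H|H|H]];
      [exists 0%N|exists 1%N|exists 2|exists 3|exists 4|exists 5] => //;
      by move: H; rewrite ?expg0 ?mulg1 ?expgSr ?mul1g ?mulgA.
  by case: H => k _ /andP[]; exists k.
have R0 y : m0 (y * hexrot)%g = m0 y by have [] := Mr y.
have R1 y : m1 (y * hexrot)%g = m1 y by have [] := Mr y.
have R2 y : m2 (y * hexrot)%g = m0 y + m1 y + m2 y - m3 y by have [] := Mr y.
have R3 y : m3 (y * hexrot)%g = m2 y by have [] := Mr y.
have B0 y : m0 (y * b)%g = m1 y by have [] := Mb y.
have B1 y : m1 (y * b)%g = m0 y by have [] := Mb y.
have B2 y : m2 (y * b)%g = m3 y by have [] := Mb y.
have B3 y : m3 (y * b)%g = m2 y by have [] := Mb y.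
have N := desc_neutral; have := N x; have := N (x * hexrot)%g; have := N (x * hexrot * hexrot)%g.
rewrite /desc ?(B0, B1, B2, B3) ?(R0, R1, R2, R3); lia.
Qed.

(** * Solving the hexagon equations *)

Section Exact2.
Variable theta : G -> V.
Hypothesis thetaA : A2 theta.

(** Antisymmetric extension from descending faces; exactly one of y and y * t descends. *)
Definition alt (f : G -> V) y := if desc y then f y else - f (y * t)%g.

(* Each hexagon equation is solved at its top tetrahedron, the unknown being shared
   equally by the two descending faces adjacent to the hexagon. *)
Fixpoint lift1 n x : V :=
  if n is n'.+1 then
    2^-1 *: \sum_(i < 3 | desc (x * a ^+ i)%g && desc (x * a ^+ i * b)%g)
      (theta (x * a ^+ i)%g - \sum_(k < 4) alt (lift1 n') (x * a ^+ i * hexrot ^+ k.+1)%g)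
  else 0.

Definition lift2 x := lift1 (height x) x.
Definition remainder y := theta y - \sum_(k < 4) alt lift2 (y * hexrot ^+ k.+1)%g.

Lemma alt_ext f g x k : desc x -> desc (x * b)%g -> (0 < k < 5)%N ->
  (forall y, (height y < height x)%N -> f y = g y) ->
  alt f (x * hexrot ^+ k)%g = alt g (x * hexrot ^+ k)%g.
Proof.
move=> dx dxb lk H; rewrite /alt; case: ifP => _; rewrite H //.
  by apply: hexagon_height => //; lia.
rewrite -height_b -!mulgA -expgSr; apply: hexagon_height => //; lia.
Qed.

Lemma lift1_stable n x : (height x <= n)%N -> lift1 n x = lift2 x.
Proof.
suff H m : (height x <= m)%N -> (height x <= n)%N -> lift1 n x = lift1 m x.
  by move=> le; apply: H.
elim: n x m => [|n IH] x [|m]; rewrite ?leqn0; try by have := height_gt0 x; lia.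
move=> lm ln /=; congr (_ *: _); apply: eq_bigr => i /andP[d1 d2]; congr (_ - _).
apply: eq_bigr => k _; apply: alt_ext => //; first by have := ltn_ord k; lia.
move=> y; rewrite (_ : height (x * a ^+ i)%g = height x).
  by move=> ly; apply: IH; lia.
by apply/inv_pow/height_a.
Qed.

Lemma lift2E x : lift2 x = 2^-1 *:
  \sum_(i < 3 | desc (x * a ^+ i)%g && desc (x * a ^+ i * b)%g) remainder (x * a ^+ i)%g.
Proof.
rewrite {1}/lift2; case E : (height x) => [|n]; first by have := height_gt0 x; lia.
rewrite /=; congr (_ *: _); apply: eq_bigr => i /andP[d1 d2]; congr (_ - _).
apply: eq_bigr => k _; apply: alt_ext => //; first by have := ltn_ord k; lia.
move=> y; rewrite (_ : height (x * a ^+ i)%g = height x).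
  by rewrite E => ly; apply: lift1_stable.
by apply/inv_pow/height_a.
Qed.

Lemma lift2_a x : lift2 (x * a)%g = lift2 x.
Proof.
rewrite lift2E [RHS]lift2E big_mkcond [in RHS]big_mkcond /=; congr (_ *: _).
rewrite big_ord_recr [RHS]big_ord_recl /= expg0 mulg1.
rewrite -[(x * a * a ^+ 2)%g]mulgA -expgS a3 mulg1 addrC; congr (_ + _).
by apply: eq_bigr => i _; rewrite -[(x * a * _)%g]mulgA -expgS.
Qed.

Lemma lift2_z x : lift2 (x * z)%g = lift2 x.
Proof.
rewrite /lift2 height_z; move: (height x) => m; elim: m x => //= n IH x.
have zm y g : (y * z * g = y * g * z)%g by rewrite -!mulgA zC.
congr (_ *: _); apply: eq_big => i; first by rewrite !zm !desc_z.
move=> _; rewrite !zm; case: thetaA => _ _ ->; congr (_ - _).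
by apply: eq_bigr => k _; rewrite /alt !zm desc_z !IH.
Qed.

Lemma alt_lift2_A1 : A1 (alt lift2).
Proof.
split=> x; rewrite /alt.
- rewrite desc_a lift2_a -[(x * a * t)%g]mulgA at2 mulgA inv_pow //; exact: lift2_a.
- rewrite desc_t -[(x * t * t)%g]mulgA t2 mulg1.
  by case: (desc x); rewrite ?opprK.
- by rewrite desc_z lift2_z -[(x * z * t)%g]mulgA -zC mulgA lift2_z.
Qed.

Lemma remainder_b x : remainder (x * b)%g = - remainder x.
Proof.
rewrite /remainder; case: thetaA => -> _ _; rewrite opprB addrC; congr (_ - _).
rewrite -sumrN (reindex_inj rev_ord_inj) /=; apply: eq_bigr => i _.
have -> : (x * b = x * t * hexrot)%g by rewrite /hexrot !mulgA -[(x * t * t)%g]mulgA t2 mulg1.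
rewrite -[(x * t * hexrot * _)%g]mulgA -expgS A1_flip; [|exact: alt_lift2_A1|lia].
by rewrite opprK; congr (alt _ (_ * _ ^+ _)%g); have := ltn_ord i; lia.
Qed.

(** By [desc_three] the other two edges of the face do not have their top here, so only the term i =
    0 survives. *)
Lemma lift2_top x : desc x -> desc (x * b)%g -> lift2 x = 2^-1 *: remainder x.
Proof.
move=> dx dxb; rewrite lift2E; congr (_ *: _); have [n1 n2] := desc_three dx dxb.
rewrite big_mkcond /= !big_ord_recl big_ord0 /= expg0 mulg1 dx dxb /=.
rewrite expg1 [(a ^+ 2)%g]expgS expg1 [(x * (a * a))%g]mulgA.
by rewrite (negPf n1) (negPf n2) !andbF !addr0.
Qed.

Lemma A2_lift : exists2 psi, A1 psi & D1 psi =1 theta.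
Proof.
exists (alt lift2) => [|x]; first exact: alt_lift2_A1.
have psiA := alt_lift2_A1; have [_ Pt Pz] := psiA; have [Tb Tt Tz] := thetaA.
have [k [dx dxb]] := hexagon_top x.
have <- : D1 (alt lift2) (x * hexrot ^+ k)%g = D1 (alt lift2) x by apply/inv_pow/D1_r.
have <- : theta (x * hexrot ^+ k)%g = theta x.
  by apply: inv_pow => y; rewrite xrb Tb Tt opprK.
move: (x * hexrot ^+ k)%g dx dxb => y dx dxb.
rewrite /D1 big_ord_recl big_ord_recr /= expg0 mulg1 (_ : bump 0 4 = 5%N) //.
have -> : (y * hexrot ^+ 5 = y * b * t * z ^+ 3)%g by rewrite r5 !mulgA.
rewrite (inv_pow (phi := alt lift2)) // Pt.
have altd w : desc w -> alt lift2 w = lift2 w by rewrite /alt => ->.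
rewrite !altd // lift2_top // (@lift2_top (y * b)%g) //; last first.
  by rewrite -mulgA b2 (inv_pow (phi := desc)) //; apply: desc_z.
rewrite remainder_b scalerN opprK [X in _ + X]addrC addrA -scalerDl.
have -> : 2^-1 + 2^-1 = 1 :> K.
  by have h2 := charK 1; field.
by rewrite scale1r /remainder subrK.
Qed.
End Exact2.
End TessellationExactness.

(** * The group of invertible matrices over the Eisenstein integers *)

(* The pair (p, q) encodes the Eisenstein integer p + q w, where w^2 = - 1 - w. *)
Definition eis : Type := (int * int)%type.
Definition eadd (x y : eis) : eis := (x.1 + y.1, x.2 + y.2).
Definition eopp (x : eis) : eis := (- x.1, - x.2).
Definition emul (x y : eis) : eis :=
  (x.1 * y.1 - x.2 * y.2, x.1 * y.2 + x.2 * y.1 - x.2 * y.2).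
Definition econj (x : eis) : eis := (x.1 - x.2, - x.2).
Definition enorm (x : eis) : int := x.1 * x.1 - x.1 * x.2 + x.2 * x.2.

Lemma emulA x y v : emul x (emul y v) = emul (emul x y) v.
Proof. by case: x y v => [? ?] [? ?] [? ?]; rewrite /emul /=; congr (_, _); ring. Qed.

Lemma emulDl x y v : emul (eadd x y) v = eadd (emul x v) (emul y v).
Proof. by case: x y v => [? ?] [? ?] [? ?]; rewrite /emul /eadd /=; congr (_, _); ring. Qed.

Lemma emulDr x y v : emul x (eadd y v) = eadd (emul x y) (emul x v).
Proof. by case: x y v => [? ?] [? ?] [? ?]; rewrite /emul /eadd /=; congr (_, _); ring. Qed.

Lemma eaddACA x y v w : eadd (eadd x y) (eadd v w) = eadd (eadd x v) (eadd y w).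
Proof. by rewrite /eadd /= !(addrACA _ y.1, addrACA _ y.2). Qed.

Lemma enormM x y : enorm (emul x y) = enorm x * enorm y.
Proof. by case: x y => [p q] [u v]; rewrite /enorm /=; ring. Qed.

Lemma enorm_ge0 x : 0 <= enorm x.
Proof. by case: x => p q; rewrite /enorm /=; nia. Qed.

Lemma enorm_eq0 x : enorm x = 0 -> x = (0, 0).
Proof.
case: x => p q; rewrite /enorm /= => H.
have q0 : q = 0 by nia.
by move: H; rewrite q0 => H; have -> : p = 0 by nia.
Qed.

Lemma enorm_le1 x : enorm x <= 1 ->
  x \in ([:: (0, 0); (1, 0); (1, 1); (0, 1); (-1, 0); (-1, -1); (0, -1)] : seq eis).
Proof.
case: x => p q; rewrite /enorm /= => H.
have [q1 q2] : -1 <= q /\ q <= 1 by nia.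
have [p1 p2] : -1 <= p /\ p <= 1 by nia.
have : q = -1 \/ q = 0 \/ q = 1 by lia.
have : p = -1 \/ p = 0 \/ p = 1 by lia.
by move=> [|[]] ep [|[]] eq; move: H; rewrite ep eq.
Qed.

(* ((m00, m01), (m10, m11)) *)
Definition emat : Type := ((eis * eis) * (eis * eis))%type.
Definition emmul (m n : emat) : emat :=
  ((eadd (emul m.1.1 n.1.1) (emul m.1.2 n.2.1),
    eadd (emul m.1.1 n.1.2) (emul m.1.2 n.2.2)),
   (eadd (emul m.2.1 n.1.1) (emul m.2.2 n.2.1),
    eadd (emul m.2.1 n.1.2) (emul m.2.2 n.2.2))).
Definition edet (m : emat) : eis :=
  eadd (emul m.1.1 m.2.2) (eopp (emul m.1.2 m.2.1)).
Definition einv (m : emat) : emat :=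
  let d := econj (edet m) in
  ((emul d m.2.2, eopp (emul d m.1.2)), (eopp (emul d m.2.1), emul d m.1.1)).
Definition eone : emat := (((1, 0), (0, 0)), ((0, 0), (1, 0))).

Lemma emmulA : associative emmul.
Proof.
move=> m n p; rewrite /emmul /= !emulDr !emulDl !emulA.
by congr ((_, _), (_, _)); apply: eaddACA.
Qed.

Lemma emul1m : left_id eone emmul.
Proof.
by move=> [[[m1 m2] [m3 m4]] [[m5 m6] [m7 m8]]];
  rewrite /emmul /eadd /emul /=; congr (((_, _), (_, _)), ((_, _), (_, _))); ring.
Qed.

Lemma edetM m n : edet (emmul m n) = emul (edet m) (edet n).
Proof.
move: m n => [[[m1 m2] [m3 m4]] [[m5 m6] [m7 m8]]] [[[n1 n2] [n3 n4]] [[n5 n6] [n7 n8]]].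
by rewrite /edet /emmul /eadd /emul /eopp /=; congr (_, _); ring.
Qed.

Lemma emulVm m : enorm (edet m) = 1 -> emmul (einv m) m = eone.
Proof.
have dK x : emul (econj x) x = (enorm x, 0).
  by case: x => p q; rewrite /emul /econj /enorm /=; congr (_, _); ring.
have -> : emmul (einv m) m = ((emul (econj (edet m)) (edet m), (0, 0)),
                              ((0, 0), emul (econj (edet m)) (edet m))).
  rewrite /einv /=; move: (econj _) => [d e].
  move: m => [[[m1 m2] [m3 m4]] [[m5 m6] [m7 m8]]].
  rewrite /edet /emmul /eadd /emul /eopp /=.
  by congr (((_, _), (_, _)), ((_, _), (_, _))); ring.
by move=> H; rewrite dK H.
Qed.

Lemma enorm_edet_inv m : enorm (edet m) = 1 -> enorm (edet (einv m)) = 1.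
Proof.
move=> H; have := congr1 (fun x => enorm (edet x)) (emulVm H).
by rewrite edetM enormM H mulr1.
Qed.

(** The units of Z[w] are the elements of norm 1, with the conjugate as inverse. This decidable form
    lets the group lists be checked by computation. *)
Definition gl2 : Type := {m : emat | enorm (edet m) == 1}.
HB.instance Definition _ := Choice.on gl2.

Lemma gl2_det (x : gl2) : enorm (edet (val x)) = 1.
Proof. by case: x => m /= /eqP. Qed.

Lemma gl2_mul_subproof (x y : gl2) : enorm (edet (emmul (val x) (val y))) == 1.
Proof. by rewrite edetM enormM !gl2_det. Qed.
Lemma gl2_inv_subproof (x : gl2) : enorm (edet (einv (val x))) == 1.
Proof. by rewrite enorm_edet_inv ?gl2_det. Qed.

Definition gl2_one : gl2 := exist (fun m => enorm (edet m) == 1) eone isT.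
Definition gl2_mul (x y : gl2) : gl2 := exist (fun m => enorm (edet m) == 1) _ (gl2_mul_subproof x y).
Definition gl2_inv (x : gl2) : gl2 := exist (fun m => enorm (edet m) == 1) _ (gl2_inv_subproof x).

Lemma gl2_mulA : associative gl2_mul.
Proof. by move=> x y w; apply: val_inj; apply: emmulA. Qed.
Lemma gl2_mul1 : left_id gl2_one gl2_mul.
Proof. by move=> x; apply: val_inj; apply: emul1m. Qed.
Lemma gl2_mulV : left_inverse gl2_one gl2_inv gl2_mul.
Proof. by move=> x; apply: val_inj; apply: emulVm; apply: gl2_det. Qed.
Lemma gl2_mulVr : right_inverse gl2_one gl2_inv gl2_mul.
Proof.
move=> x; rewrite -[LHS]gl2_mul1 -[X in gl2_mul X _](gl2_mulV (gl2_inv x)) -gl2_mulA.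
by rewrite (gl2_mulA _ x) gl2_mulV gl2_mul1 gl2_mulV.
Qed.
Lemma gl2_mul1r : right_id gl2_one gl2_mul.
Proof. by move=> x; rewrite -(gl2_mulV x) gl2_mulA gl2_mulVr gl2_mul1. Qed.

HB.instance Definition _ := isGroup.Build gl2 gl2_mulA gl2_mul1 gl2_mul1r gl2_mulV gl2_mulVr.

Definition mk_gl2 (m : emat) (Hm : enorm (edet m) == 1) : gl2 :=
  exist (fun m => enorm (edet m) == 1) m Hm.
(** Up to units, on the vertices v0 = (1,0), v1 = (0,1), v2 = (1,1), v3 = (1,1+w): [gl2_a] cycles
    v0, v1, v2; [gl2_b] swaps v0 with v1 and v2 with v3; [gl2_t] swaps v0 with v1, fixes v2 and
    moves v3 across their face. The scalar -w in [gl2_z] generates the units. *)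
Definition gl2_a : gl2 := @mk_gl2 (((0, 0), (-1, 0)), ((1, 0), (-1, 0))) isT.
Definition gl2_b : gl2 := @mk_gl2 (((0, 0), (-1, -1)), ((0, -1), (0, 0))) isT.
Definition gl2_t : gl2 := @mk_gl2 (((0, 0), (1, 0)), ((1, 0), (0, 0))) isT.
Definition gl2_z : gl2 := @mk_gl2 (((0, -1), (0, 0)), ((0, 0), (0, -1))) isT.

(* A positive definite Hermitian form, integral on Z[w]^2 and equal to 1 on the
   vectors (1,0), (0,1), (1,1), (1,1+w), the ideal vertices of a tetrahedron. *)
Definition hform (x y : eis) : int :=
  enorm x + enorm y - x.1 * y.1 - x.2 * y.2 + x.2 * y.1.

Definition vnorm0 (g : gl2) := hform (val g).1.1 (val g).2.1.
Definition vnorm1 (g : gl2) := hform (val g).1.2 (val g).2.2.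
Definition vnorm2 (g : gl2) :=
  hform (eadd (val g).1.1 (val g).1.2) (eadd (val g).2.1 (val g).2.2).
Definition vnorm3 (g : gl2) :=
  hform (eadd (val g).1.1 (emul (1, 1) (val g).1.2))
        (eadd (val g).2.1 (emul (1, 1) (val g).2.2)).

Lemma gl2_ind (P : gl2 -> Prop) :
  (forall m1 m2 m3 m4 m5 m6 m7 m8 H,
    P (@mk_gl2 (((m1, m2), (m3, m4)), ((m5, m6), (m7, m8))) H)) -> forall x, P x.
Proof. by move=> H [[[[m1 m2] [m3 m4]] [[m5 m6] [m7 m8]]] Hm]; apply: H. Qed.

Ltac vnorm_ring := rewrite /vnorm0 /vnorm1 /vnorm2 /vnorm3 /= /hform /enorm /emul /eadd /=; ring.

Lemma vnorm_a x : [/\ vnorm0 (x * gl2_a)%g = vnorm1 x, vnorm1 (x * gl2_a)%g = vnorm2 x,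
  vnorm2 (x * gl2_a)%g = vnorm0 x & vnorm3 (x * gl2_a)%g = vnorm3 x].
Proof. by elim/gl2_ind: x => *; split; vnorm_ring. Qed.

Lemma vnorm_b x : [/\ vnorm0 (x * gl2_b)%g = vnorm1 x, vnorm1 (x * gl2_b)%g = vnorm0 x,
  vnorm2 (x * gl2_b)%g = vnorm3 x & vnorm3 (x * gl2_b)%g = vnorm2 x].
Proof. by elim/gl2_ind: x => *; split; vnorm_ring. Qed.

Lemma vnorm_t x : [/\ vnorm0 (x * gl2_t)%g = vnorm1 x, vnorm1 (x * gl2_t)%g = vnorm0 x,
  vnorm2 (x * gl2_t)%g = vnorm2 x &
  vnorm3 (x * gl2_t)%g = vnorm0 x + vnorm1 x + vnorm2 x - vnorm3 x].
Proof. by elim/gl2_ind: x => *; split; vnorm_ring. Qed.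

Lemma vnorm_z x : [/\ vnorm0 (x * gl2_z)%g = vnorm0 x, vnorm1 (x * gl2_z)%g = vnorm1 x,
  vnorm2 (x * gl2_z)%g = vnorm2 x & vnorm3 (x * gl2_z)%g = vnorm3 x].
Proof. by elim/gl2_ind: x => *; split; vnorm_ring. Qed.

(** In the values at the four vertices, this quadratic form is -3 times the determinant of a
    Hermitian form. That of [hform] is 2/3, and x multiplies it by the norm of det x. *)
Lemma vnorm_sq x : vnorm0 x * vnorm0 x + vnorm1 x * vnorm1 x + vnorm2 x * vnorm2 x
  + vnorm3 x * vnorm3 x - (vnorm0 x * vnorm1 x + vnorm0 x * vnorm2 x
  + vnorm0 x * vnorm3 x + vnorm1 x * vnorm2 x + vnorm1 x * vnorm3 x
  + vnorm2 x * vnorm3 x) = -2%:Z.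
Proof.
have -> : -2%:Z = -2 * enorm (edet (val x)) by rewrite gl2_det mulr1.
elim/gl2_ind: x => *; rewrite /vnorm0 /vnorm1 /vnorm2 /vnorm3 /edet /=.
rewrite /hform /enorm /emul /eadd /eopp /=; ring.
Qed.

(** Completing the square; the pair (1, 2) is 1 + 2w, of norm 3. *)
Lemma hform_left x y :
  3 * hform x y = 2 * enorm x + enorm (eadd (emul (1, 2) y) (emul (0, -1) x)).
Proof. by case: x y => p q [u v]; rewrite /hform /enorm /emul /eadd /=; ring. Qed.

Lemma hform_right x y :
  3 * hform x y = 2 * enorm y + enorm (eadd (emul (1, 2) x) (emul (-1, -1) y)).
Proof. by case: x y => p q [u v]; rewrite /hform /enorm /emul /eadd /=; ring. Qed.

Lemma hform_gt0 x y : (x, y) <> ((0, 0), (0, 0)) -> 0 < hform x y.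
Proof.
move=> H; rewrite ltNge; apply/negP => le0; apply: H.
have lin (h n1 n2 n3 n4 : int) : h <= 0 -> 3 * h = 2 * n1 + n3 -> 3 * h = 2 * n2 + n4 ->
  0 <= n1 -> 0 <= n2 -> 0 <= n3 -> 0 <= n4 -> n1 = 0 /\ n2 = 0 by lia.
have [x0 y0] := lin _ _ _ _ _ le0 (hform_left x y) (hform_right x y)
  (enorm_ge0 _) (enorm_ge0 _) (enorm_ge0 _) (enorm_ge0 _).
by rewrite (enorm_eq0 x0) (enorm_eq0 y0).
Qed.

Lemma hform_eq1 x y : hform x y = 1 -> enorm x <= 1 /\ enorm y <= 1.
Proof.
move=> H.
have lin (h n1 n2 n3 n4 : int) : h = 1 -> 3 * h = 2 * n1 + n3 -> 3 * h = 2 * n2 + n4 ->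
  0 <= n3 -> 0 <= n4 -> n1 <= 1 /\ n2 <= 1 by lia.
exact: (lin _ _ _ _ _ H (hform_left x y) (hform_right x y) (enorm_ge0 _) (enorm_ge0 _)).
Qed.

(* The columns x v_i are nonzero since the determinant against another column is a unit. *)
Lemma vnorm_gt0 x : [/\ 0 < vnorm0 x, 0 < vnorm1 x, 0 < vnorm2 x & 0 < vnorm3 x].
Proof.
have pos (y : gl2) u v : edet (val y) = eadd (emul u (val y).2.2) (eopp (emul (val y).1.2 v)) ->
    0 < hform u v.
  move=> e; apply: hform_gt0 => -[u0 v0]; have := gl2_det y.
  by rewrite e u0 v0 /enorm /emul /eadd /eopp /= !(mul0r, mulr0, oppr0, addr0, subr0).
have p0 y : 0 < vnorm0 y by apply: (pos y).
have p3 y : 0 < vnorm3 y.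
  apply: (pos y); elim/gl2_ind: y => *.
  by rewrite /edet /emul /eadd /eopp /=; congr (_, _); rewrite !mul1r; ring.
have [e1 e2 _ _] := vnorm_a x; have [e3 _ _ _] := vnorm_a (x * gl2_a)%g.
by split; rewrite -?e2 -?e1 -?e3.
Qed.

(** By [hform_eq1] every entry is 0 or a unit, which leaves 7^4 candidate matrices for an exhaustive
    check. *)
Lemma vnorm_one x : vnorm0 x = 1 -> vnorm1 x = 1 -> vnorm2 x = 1 -> vnorm3 x = 1 ->
  x \in L0 gl2_a gl2_b gl2_z.
Proof.
pose units : seq eis := [:: (0, 0); (1, 0); (1, 1); (0, 1); (-1, 0); (-1, -1); (0, -1)].
pose cols := [seq (u, v) | u <- units, v <- units].
pose mats : seq emat := [seq ((u.1, v.1), (u.2, v.2)) | u <- cols, v <- cols].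
pose raw : seq emat := map val (L0 gl2_a gl2_b gl2_z).
have all_raw : all (fun m : emat =>
  [&& hform m.1.1 m.2.1 == 1, hform m.1.2 m.2.2 == 1,
      hform (eadd m.1.1 m.1.2) (eadd m.2.1 m.2.2) == 1 &
      hform (eadd m.1.1 (emul (1, 1) m.1.2)) (eadd m.2.1 (emul (1, 1) m.2.2)) == 1]
  ==> (m \in raw)) mats.
  by vm_compute.
move=> H0 H1 H2 H3; suff : val x \in raw.
  by case/mapP => y yL /val_inj ->.
have colsP u v : hform u v = 1 -> (u, v) \in cols.
  by case/hform_eq1 => /enorm_le1 Hu /enorm_le1 Hv; apply: allpairs_f.
have xm : val x \in mats.
  have -> : val x = (((val x).1.1, (val x).1.2), ((val x).2.1, (val x).2.2)).
    by case: (val x) => [[? ?] [? ?]].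
  exact: (allpairs_f (fun u v : eis * eis => ((u.1, v.1), (u.2, v.2)))
                     (colsP _ _ H0) (colsP _ _ H1)).
have /implyP := allP all_raw _ xm; apply.
by apply/and4P; split; apply/eqP.
Qed.

Lemma L0_perm g : g \in [:: gl2_a; gl2_b; gl2_z] ->
  perm_eq [seq (g * h)%g | h <- L0 gl2_a gl2_b gl2_z] (L0 gl2_a gl2_b gl2_z).
Proof.
move=> H; apply: (@perm_map_inj _ _ val val_inj).
suff /allP/(_ _ H) : all (fun g : gl2 => perm_eq (map val [seq (g * h)%g | h <- L0 gl2_a gl2_b gl2_z])
  (map val (L0 gl2_a gl2_b gl2_z))) [:: gl2_a; gl2_b; gl2_z] by [].
by vm_compute.
Qed.

(** * Stabilizers and their idempotents *)

Section Projector.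
Variables (K : fieldType) (G : groupType).
Hypothesis charK : forall n, n.+1%:R != 0 :> K.
Implicit Types (L gens : seq (bool * G)).

(* The idempotent (1/#|L|) sum_(h in L) chi(h) h of a group L with sign character chi. *)
Definition idem_list L : seq (K * G) :=
  [seq ((size L)%:R^-1 * (-1) ^+ nat_of_bool p.1, p.2) | p <- L].

Definition semi_inv (V : lmodType K) (phi : G -> V) (p : bool * G) :=
  forall x, phi (x * p.2)%g = (-1) ^+ nat_of_bool p.1 *: phi x.

Lemma semi_inv1 (V : lmodType K) (phi : G -> V) : semi_inv phi (false, 1%g).
Proof. by move=> x; rewrite mulg1 scale1r. Qed.

Lemma semi_invM (V : lmodType K) (phi : G -> V) s1 g1 s2 g2 :
  semi_inv phi (s1, g1) -> semi_inv phi (s2, g2) ->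
  semi_inv phi (s1 (+) s2, (g1 * g2)%g).
Proof.
move=> H1 H2 x /=; rewrite mulgA H2 H1 /= scalerA.
by case: s1 s2 {H1 H2} => [] []; rewrite ?mulr1 ?mul1r ?mulrNN ?mulr1.
Qed.

Lemma semi_invX (V : lmodType K) (phi : G -> V) g k :
  semi_inv phi (false, g) -> semi_inv phi (false, (g ^+ k)%g).
Proof.
move=> H; elim: k => [|k IH]; first exact: semi_inv1.
by rewrite expgS; apply: (semi_invM H IH).
Qed.

Variables gens L : seq (bool * G).
Hypothesis genL : forall (V : lmodType K) (phi : G -> V),
  (forall p, p \in gens -> semi_inv phi p) -> forall p, p \in L -> semi_inv phi p.
Hypothesis permL : forall g, g \in gens ->
  perm_eq [seq (g.1 (+) p.1, (g.2 * p.2)%g) | p <- L] L.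
Hypothesis sizeL : (0 < size L)%N.

Lemma radd_idem (V : lmodType K) (phi : G -> V) p :
  p \in gens -> semi_inv (radd (idem_list L) phi) p.
Proof.
move=> pg x; rewrite /radd /idem_list !big_map.
rewrite -[in RHS](perm_big _ (permL pg)) big_map /= scaler_sumr.
apply: eq_bigr => q _; rewrite scalerA mulgA; congr (_ *: _).
rewrite mulrCA; congr (_ * _).
by case: p.1 q.1 => [] []; rewrite ?mulr1 ?mul1r ?mulrNN ?mulr1.
Qed.

Lemma inA_idemP (V : lmodType K) (phi : G -> V) :
  inA (idem_list L) phi <-> forall p, p \in gens -> semi_inv phi p.
Proof.
split=> [H p pg x|H x].
  by rewrite -!(H _); apply: radd_idem.
rewrite /radd /idem_list big_map.
rewrite big_seq (eq_bigr (fun=> (size L)%:R^-1 *: phi x)); last first.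
  move=> p pL /=; rewrite (genL H pL) scalerA -mulrA.
  by case: p.1; rewrite /= ?mulrNN !mulr1.
rewrite -big_seq big_const_seq count_predT iter_addr_0 -scaler_nat scalerA mulfV ?scale1r //.
by case: (size L) sizeL.
Qed.

Lemma inA_radd_idem (V : lmodType K) (phi : G -> V) :
  inA (idem_list L) (radd (idem_list L) phi).
Proof. by apply/inA_idemP => p; apply: radd_idem. Qed.
End Projector.

Definition gens0 : seq (bool * gl2) := [:: (false, gl2_a); (false, gl2_b); (false, gl2_z)].
Definition gens1 : seq (bool * gl2) := [:: (false, gl2_a); (true, gl2_t); (false, gl2_z)].
Definition gens2 : seq (bool * gl2) := [:: (true, gl2_b); (true, gl2_t); (false, gl2_z)].

(** Stabilizers of a tetrahedron, a triangle and an edge: modulo scalars A_4, S_3 and the dihedral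
    group of order 12. The boolean marks reversal of the dual cell. *)
Definition S0 : seq (bool * gl2) := [seq (false, h) | h <- L0 gl2_a gl2_b gl2_z].
Definition S1 : seq (bool * gl2) :=
  [seq (false, h) | h <- La gl2_a gl2_z] ++ [seq (true, gl2_t * h)%g | h <- La gl2_a gl2_z].
Definition Lr : seq gl2 :=
  [seq ((gl2_t * gl2_b) ^+ i * gl2_z ^+ k)%g | i <- iota 0 6, k <- iota 0 6].
Definition S2 : seq (bool * gl2) :=
  [seq (false, h) | h <- Lr] ++ [seq (true, gl2_b * h)%g | h <- Lr].

Definition sval (p : bool * gl2) : bool * emat := (p.1, val p.2).

Lemma sval_inj : injective sval.
Proof. by move=> [s g] [s' g'] [-> /val_inj ->]. Qed.

Lemma S_perm gens S :
  all (fun g : bool * gl2 => perm_eq [seq (g.1 (+) p.1, emmul (val g.2) (val p.2)) | p <- S]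
    (map sval S)) gens ->
  forall g, g \in gens -> perm_eq [seq (g.1 (+) p.1, (g.2 * p.2)%g) | p <- S] S.
Proof.
move=> /allP H g /H {}H; apply: (perm_map_inj sval_inj).
by rewrite -map_comp.
Qed.

Lemma S0_perm g : g \in gens0 ->
  perm_eq [seq (g.1 (+) p.1, (g.2 * p.2)%g) | p <- S0] S0.
Proof. by apply: S_perm; vm_compute. Qed.

Lemma S1_perm g : g \in gens1 ->
  perm_eq [seq (g.1 (+) p.1, (g.2 * p.2)%g) | p <- S1] S1.
Proof. by apply: S_perm; vm_compute. Qed.

Lemma S2_perm g : g \in gens2 ->
  perm_eq [seq (g.1 (+) p.1, (g.2 * p.2)%g) | p <- S2] S2.
Proof. by apply: S_perm; vm_compute. Qed.

Section Generation.
Variables (K : fieldType) (V : lmodType K) (phi : gl2 -> V).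

Lemma semi_inv_La : semi_inv phi (false, gl2_a) -> semi_inv phi (false, gl2_z) ->
  forall h, h \in La gl2_a gl2_z -> semi_inv phi (false, h).
Proof.
move=> Ha Hz h /allpairsP[[i k] [_ _ ->]] /=.
by apply: (semi_invM (semi_invX i Ha) (semi_invX k Hz)).
Qed.

Lemma S0_gen : (forall p, p \in gens0 -> semi_inv phi p) ->
  forall p, p \in S0 -> semi_inv phi p.
Proof.
move=> H p /mapP[h hL ->].
have Ha : semi_inv phi (false, gl2_a) by apply: H; rewrite !inE eqxx ?orbT.
have Hb : semi_inv phi (false, gl2_b) by apply: H; rewrite !inE eqxx ?orbT.
have Hz : semi_inv phi (false, gl2_z) by apply: H; rewrite !inE eqxx ?orbT.
move: hL; rewrite mem_cat => /orP[|/allpairsP[[i k] [_ _ ->]]] /=.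
  exact: semi_inv_La.
apply: (semi_invM (s1 := false) (s2 := false)); last exact: semi_invX.
apply: (semi_invM (s1 := false) (s2 := false)); last exact: semi_invX.
by apply: (semi_invM (s1 := false) (s2 := false)) => //; apply: semi_invX.
Qed.

Lemma S1_gen : (forall p, p \in gens1 -> semi_inv phi p) ->
  forall p, p \in S1 -> semi_inv phi p.
Proof.
move=> H.
have Ha : semi_inv phi (false, gl2_a) by apply: H; rewrite !inE eqxx ?orbT.
have Ht : semi_inv phi (true, gl2_t) by apply: H; rewrite !inE eqxx ?orbT.
have Hz : semi_inv phi (false, gl2_z) by apply: H; rewrite !inE eqxx ?orbT.
move=> p; rewrite mem_cat => /orP[] /mapP[h /(semi_inv_La Ha Hz) Hh ->] //.
exact: (semi_invM Ht Hh).
Qed.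

Lemma S2_gen : (forall p, p \in gens2 -> semi_inv phi p) ->
  forall p, p \in S2 -> semi_inv phi p.
Proof.
move=> H.
have Hb : semi_inv phi (true, gl2_b) by apply: H; rewrite !inE eqxx ?orbT.
have Ht : semi_inv phi (true, gl2_t) by apply: H; rewrite !inE eqxx ?orbT.
have Hz : semi_inv phi (false, gl2_z) by apply: H; rewrite !inE eqxx ?orbT.
have HL h : h \in Lr -> semi_inv phi (false, h).
  move=> /allpairsP[[i k] [_ _ ->]] /=.
  apply: (semi_invM (s1 := false) (s2 := false)); last exact: semi_invX.
  by apply: semi_invX; apply: (semi_invM Ht Hb).
move=> p; rewrite mem_cat => /orP[] /mapP[h /HL Hh ->] //.
exact: (semi_invM Hb Hh).
Qed.
End Generation.

(** * The Euler characteristic in terms of stabilizer invariants *)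

Section EulerCharacteristic.
Variables (K : fieldType) (V : vectType K) (rho : gl2 -> V -> V).
Hypothesis charK : forall n, n.+1%:R != 0 :> K.
Hypothesis rhoM : forall g h v, rho (g * h)%g v = rho g (rho h v).
Hypothesis rho1 : forall v, rho 1%g v = v.
Hypothesis rhoP : forall g k u v, rho g (u + k *: v) = rho g u + k *: rho g v.
Implicit Types (phi psi : gl2 -> V).

Definition D0_list : seq (K * gl2) := [:: (1, gl2_t); (-1, 1%g)].
Definition D1_list : seq (K * gl2) := [seq (1, ((gl2_t * gl2_b) ^+ k)%g) | k <- iota 0 6].

Lemma radd_D0 phi x : radd D0_list phi x = D0 gl2_t phi x.
Proof. by rewrite /radd !big_cons big_nil /= mulg1 scale1r scaleN1r addr0. Qed.

Lemma radd_D1 phi x : radd D1_list phi x = D1 gl2_b gl2_t phi x.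
Proof.
rewrite /radd big_map -[iota 0 6]/(index_iota 0 6) big_mkord.
by apply: eq_bigr => k _; rewrite scale1r.
Qed.

Lemma inA_E0 phi : inA (idem_list K S0) phi <-> A0 gl2_a gl2_b gl2_z phi.
Proof.
rewrite (inA_idemP charK (@S0_gen K) S0_perm isT); split=> [H|[Ha Hb Hz] p].
  have E p : p \in gens0 -> _ := H p.
  by split=> x; [rewrite (E (false, gl2_a) _ x)|rewrite (E (false, gl2_b) _ x)|rewrite (E (false, gl2_z) _ x)];
    rewrite ?scale1r ?scaleN1r ?inE ?eqxx ?orbT.
by rewrite !inE => /or3P[] /eqP-> x; rewrite scale1r.
Qed.

Lemma inA_E1 phi : inA (idem_list K S1) phi <-> A1 gl2_a gl2_t gl2_z phi.
Proof.
rewrite (inA_idemP charK (@S1_gen K) S1_perm isT); split=> [H|[Ha Ht Hz] p].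
  have E p : p \in gens1 -> _ := H p.
  by split=> x; [rewrite (E (false, gl2_a) _ x)|rewrite (E (true, gl2_t) _ x)|rewrite (E (false, gl2_z) _ x)];
    rewrite ?scale1r ?scaleN1r ?inE ?eqxx ?orbT.
by rewrite !inE => /or3P[] /eqP-> x; rewrite ?scale1r ?scaleN1r.
Qed.

Lemma inA_E2 phi : inA (idem_list K S2) phi <-> A2 gl2_b gl2_t gl2_z phi.
Proof.
rewrite (inA_idemP charK (@S2_gen K) S2_perm isT); split=> [H|[Hb Ht Hz] p].
  have E p : p \in gens2 -> _ := H p.
  by split=> x; [rewrite (E (true, gl2_b) _ x)|rewrite (E (true, gl2_t) _ x)|rewrite (E (false, gl2_z) _ x)];
    rewrite ?scale1r ?scaleN1r ?inE ?eqxx ?orbT.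
by rewrite !inE => /or3P[] /eqP-> x; rewrite ?scale1r ?scaleN1r.
Qed.

Lemma gl2_zC (x : gl2) : (x * gl2_z = gl2_z * x)%g.
Proof.
apply: val_inj; elim/gl2_ind: x => *.
by rewrite /= /emmul /emul /eadd /=; congr (((_, _), (_, _)), ((_, _), (_, _))); ring.
Qed.
Lemma gl2_z6 : (gl2_z ^+ 6 = 1)%g. Proof. exact: val_inj. Qed.
Lemma gl2_a3 : (gl2_a ^+ 3 = 1)%g. Proof. exact: val_inj. Qed.
Lemma gl2_b2 : (gl2_b * gl2_b = gl2_z ^+ 3)%g. Proof. exact: val_inj. Qed.
Lemma gl2_t2 : (gl2_t * gl2_t = 1)%g. Proof. exact: val_inj. Qed.
Lemma gl2_at : (gl2_a * gl2_t = gl2_t * gl2_a ^+ 2)%g. Proof. exact: val_inj. Qed.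
Lemma gl2_r6 : ((gl2_t * gl2_b) ^+ 6 = 1)%g. Proof. exact: val_inj. Qed.

Variables (I0 I1 I2 : {vspace V}) (d0 d1 : 'End(V)).
Hypothesis I0P : forall v, v \in I0 <-> lact rho (idem_list K S0) v = v.
Hypothesis I1P : forall v, v \in I1 <-> lact rho (idem_list K S1) v = v.
Hypothesis I2P : forall v, v \in I2 <-> lact rho (idem_list K S2) v = v.
Hypothesis d0P : forall v, d0 v = lact rho D0_list v.
Hypothesis d1P : forall v, d1 v = lact rho D1_list v.

Lemma gl2_barH_euler : exists d : nat -> nat,
  [/\ forall j, barH rho j (d j), forall j, (2 < j)%N -> d j = 0%N &
      (d 0%N)%:Z - (d 1%N)%:Z + (d 2%N)%:Z = (\dim I0)%:Z - (\dim I1)%:Z + (\dim I2)%:Z].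
Proof.
have va := vnorm_a; have vb := vnorm_b; have vt := vnorm_t; have vz := vnorm_z.
refine (barH_euler rhoM rho1 rhoP _ _ _ _ _ _ _ _ _ _ _ I0P I1P I2P d0P d1P).
- by move=> phi; apply: (inA_radd_idem charK (@S0_gen K) S0_perm).
- by move=> phi; apply: (inA_radd_idem charK (@S1_gen K) S1_perm).
- by move=> phi; apply: (inA_radd_idem charK (@S2_gen K) S2_perm).
- by move=> v; apply/inA_E0; split.
- by move=> v x; rewrite radd_D0 /D0 subrr.
- move=> phi /inA_E0 H; apply/inA_E1.
  have -> : radd D0_list phi = D0 gl2_t phi by apply/funext => x; apply: radd_D0.
  exact: (D0_A gl2_zC gl2_t2 gl2_at H).
- move=> phi /inA_E1 H; apply/inA_E2.
  have -> : radd D1_list phi = D1 gl2_b gl2_t phi by apply/funext => x; apply: radd_D1.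
  exact: (D1_A gl2_zC gl2_z6 gl2_b2 gl2_t2 gl2_r6 H).
- move=> phi /inA_E0 H x; rewrite radd_D1.
  have -> : radd D0_list phi = D0 gl2_t phi by apply/funext => y; apply: radd_D0.
  exact: (D1_D0 gl2_r6 x H).
- move=> phi /inA_E0 H dphi; exists (phi 1%g).
  apply: (A0_exact va vb vt vnorm_gt0 vnorm_sq vnorm_one H) => x.
  by rewrite -radd_D0.
- move=> psi /inA_E1 H dpsi.
  have [|phi phiA dphi] := A1_exact charK gl2_zC gl2_z6 gl2_b2 gl2_t2 gl2_at gl2_r6 va vb vt vz
    vnorm_gt0 vnorm_sq L0_perm H; first by move=> x; rewrite -radd_D1.
  by exists phi; [apply/inA_E0|move=> x; rewrite radd_D0].
- move=> theta /inA_E2 H.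
  have [psi psiA dpsi] := A2_lift charK gl2_zC gl2_z6 gl2_a3 gl2_b2 gl2_t2 gl2_at gl2_r6 va vb vt vz
    vnorm_gt0 vnorm_sq H.
  by exists psi; [apply/inA_E1|move=> x; rewrite radd_D1].
Qed.
End EulerCharacteristic.

(** * Symmetric powers and their traces *)

Lemma det_mx2 (R : comNzRingType) (g : 'M[R]_2) :
  \det g = g i0 i0 * g i1 i1 - g i0 i1 * g i1 i0.
Proof.
rewrite (expand_det_row g i0) !big_ord_recl big_ord0 addr0 /cofactor !det_mx11 !mxE.
rewrite /= expr0 mul1r expr1 mulN1r mulrN.
by congr (g _ _ * g _ _ - g _ _ * g _ _); apply: val_inj.
Qed.

Lemma trace_mx2 (R : comNzRingType) (g : 'M[R]_2) : \tr g = g i0 i0 + g i1 i1.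
Proof.
rewrite /mxtrace !big_ord_recl big_ord0 addr0.
by congr (g _ _ + g _ _); apply: val_inj.
Qed.

Section SymmetricPower.
Variable R : comNzRingType.
Implicit Types (g h : 'M[R]_2) (f : {poly R}).

Definition sym_col0 g : {poly R} := (g i0 i0)%:P + (g i1 i0)%:P * 'X.
Definition sym_col1 g : {poly R} := (g i0 i1)%:P + (g i1 i1)%:P * 'X.

Definition symp (n : nat) g : 'M[R]_(n.+1) :=
  \matrix_(i < n.+1, k < n.+1) ((sym_col0 g ^+ (n - k) * sym_col1 g ^+ k)`_i).

(* f(X) |-> sym_col0^n f(sym_col1 / sym_col0) for deg f <= n *)
Definition homog n g f : {poly R} :=
  \sum_(k < n.+1) f`_k *: (sym_col0 g ^+ (n - k) * sym_col1 g ^+ k).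

Lemma homog_mul n g c d f : (size f <= n.+1)%N ->
  homog n.+1 g ((c%:P + d%:P * 'X) * f) =
  (c%:P * sym_col0 g + d%:P * sym_col1 g) * homog n g f.
Proof.
move=> sf; rewrite mulrDl /homog; set P := sym_col0 g; set Q := sym_col1 g.
under eq_bigr => k _ do rewrite coefD coefCM -mulrA coefCM coefXM scalerDl.
rewrite big_split /= big_ord_recr /= [f`_n.+1]nth_default // mulr0 scale0r addr0.
rewrite [X in _ + X]big_ord_recl /= mulr0 scale0r add0r mulrDl !mulr_sumr.
congr (_ + _); apply: eq_bigr => k _.
  by rewrite subSn ?leq_ord // exprS -scalerA -scalerAr -!mul_polyC; ring.
by rewrite /bump /= add1n subSS exprS -scalerA -scalerAr -!mul_polyC; ring.
Qed.

Lemma size_lin (c d : R) : (size (c%:P + d%:P * 'X : {poly R})%R <= 2)%N.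
Proof. by rewrite addrC size_MXaddC; case: ifP => // _; apply: size_polyC_leq1. Qed.

Lemma size_sym_cols g i j : (size (sym_col0 g ^+ i * sym_col1 g ^+ j)%R <= (i + j).+1)%N.
Proof.
have E c d k : (size ((c%:P + d%:P * 'X : {poly R}) ^+ k)%R <= k.+1)%N.
  by apply: leq_trans (size_poly_exp_leq _ _) _; have := size_lin c d; nia.
apply: leq_trans (size_polyMleq _ _) _.
have E0 : (size (sym_col0 g ^+ i) <= i.+1)%N := E _ _ _.
have E1 : (size (sym_col1 g ^+ j) <= j.+1)%N := E _ _ _.
lia.
Qed.

Lemma sym_col0M g h :
  (h i0 i0)%:P * sym_col0 g + (h i1 i0)%:P * sym_col1 g = sym_col0 (g *m h).
Proof.
rewrite /sym_col0 /sym_col1 !mxE !big_ord_recl !big_ord0 !addr0.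
rewrite (_ : ord0 = i0) // (_ : lift i0 ord0 = i1); last exact: val_inj.
by rewrite !polyCD !polyCM; ring.
Qed.

Lemma sym_col1M g h :
  (h i0 i1)%:P * sym_col0 g + (h i1 i1)%:P * sym_col1 g = sym_col1 (g *m h).
Proof.
rewrite /sym_col0 /sym_col1 !mxE !big_ord_recl !big_ord0 !addr0.
rewrite (_ : ord0 = i0) // (_ : lift i0 ord0 = i1); last exact: val_inj.
by rewrite !polyCD !polyCM; ring.
Qed.

(** The substitution is multiplicative on linear factors, which are peeled off one at a time;
    comparing coefficients then gives functoriality of S^n. *)
Lemma homog_cols g h i j :
  homog (i + j)%N g (sym_col0 h ^+ i * sym_col1 h ^+ j) =
  sym_col0 (g *m h) ^+ i * sym_col1 (g *m h) ^+ j.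
Proof.
elim: i => [|i IH].
  elim: j => [|j IH].
    by rewrite /homog big_ord_recl big_ord0 !expr0 !mulr1 coef1 scale1r addr0.
  rewrite expr0 mul1r add0n exprS homog_mul; last first.
    by have := size_sym_cols h 0 j; rewrite expr0 mul1r.
  by move: IH; rewrite !expr0 !mul1r add0n => ->; rewrite sym_col1M exprS.
by rewrite addSn exprS -mulrA homog_mul ?size_sym_cols // IH sym_col0M exprS mulrA.
Qed.

Lemma sympM n g h : symp n (g *m h) = symp n g *m symp n h.
Proof.
apply/matrixP => i k; rewrite !mxE -homog_cols.
have -> : (n - k + k)%N = n by rewrite subnK ?leq_ord.
by rewrite coef_sum; apply: eq_bigr => l _; rewrite !mxE coefZ mulrC.
Qed.

Lemma symp1 n : symp n 1%:M = 1%:M.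
Proof.
apply/matrixP => i k; rewrite !mxE /sym_col0 /sym_col1 !mxE /=.
by rewrite mul0r addr0 expr1n mul1r add0r mul1r coefXn.
Qed.

Lemma symp_conj n g h : h *m g = 1%:M -> forall x, \tr (symp n (g *m x *m h)) = \tr (symp n x).
Proof. by move=> e x; rewrite !sympM mxtrace_mulC mulmxA -sympM e symp1 mul1mx. Qed.

Lemma coef_lin_exp (c d : R) k : ((c%:P + d%:P * 'X) ^+ k)`_k = d ^+ k.
Proof.
elim: k => [|k IH]; first by rewrite coef1.
rewrite exprS mulrDl coefD coefCM -mulrA coefCM coefXM /= IH exprS.
rewrite nth_default ?mulr0 ?add0r //.
by apply: leq_trans (size_poly_exp_leq _ _) _; have := size_lin c d; nia.
Qed.

Lemma trace_symp_trig n g : g i1 i0 = 0 ->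
  \tr (symp n g) = \sum_(k < n.+1) g i0 i0 ^+ (n - k) * g i1 i1 ^+ k.
Proof.
move=> g10; apply: eq_bigr => k _; rewrite mxE /sym_col0 g10 mul0r addr0.
by rewrite -rmorphXn coefCM coef_lin_exp.
Qed.

Lemma trace_symp_rec_trig n g : g i1 i0 = 0 ->
  \tr (symp n.+2 g) = \tr g * \tr (symp n.+1 g) - \det g * \tr (symp n g).
Proof.
move=> g10; rewrite !trace_symp_trig //.
set l := g i0 i0; set m := g i1 i1.
have S k : \sum_(i < k.+2) l ^+ (k.+1 - i) * m ^+ i =
    l * (\sum_(i < k.+1) l ^+ (k - i) * m ^+ i) + m ^+ k.+1.
  rewrite big_ord_recr /= subnn mul1r mulr_sumr; congr (_ + _).
  by apply: eq_bigr => i _; rewrite subSn ?leq_ord // exprS mulrA.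
rewrite trace_mx2 det_mx2 -/l -/m g10 mulr0 subr0.
by rewrite !S [m ^+ n.+2]exprS; ring.
Qed.
End SymmetricPower.

Lemma trace_symp0 (R : comNzRingType) (g : 'M[R]_2) : \tr (symp 0 g) = 1.
Proof. by rewrite /mxtrace big_ord_recl big_ord0 mxE /= !expr0 mulr1 coef1 addr0. Qed.

Lemma trace_symp1 (R : comNzRingType) (g : 'M[R]_2) : \tr (symp 1 g) = \tr g.
Proof.
rewrite /mxtrace !big_ord_recl !big_ord0 !mxE !addr0 /= subn0 subnn.
rewrite !expr0 !expr1 mulr1 mul1r /sym_col0 /sym_col1 !coefD !coefCM !coefC !coefX /=.
rewrite mulr0 addr0 mulr1 add0r.
by congr (g _ _ + g _ _); apply: val_inj.
Qed.

(** A left eigenvector, taken as second row of b, makes the second row of the conjugate a multiple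
    of the second basis row. A standard row vector completes it to an invertible matrix. *)
Lemma trigonalize2 (F : closedFieldType) (g : 'M[F]_2) :
  exists b c : 'M[F]_2, c *m b = 1%:M /\ (b *m g *m c) i1 i0 = 0.
Proof.
have [l] : exists l, root (char_poly g) l.
  by apply: closed_rootP; rewrite size_char_poly.
rewrite -eigenvalue_root_char => /eigenvalueP[v vg v0].
suff [b [bu bv]] : exists b : 'M[F]_2, b \in unitmx /\ row i1 b = v.
  exists b, (invmx b); split; first exact: mulVmx.
  have e : row i1 (b *m g *m invmx b) = l *: delta_mx 0 i1.
    rewrite !row_mul bv vg -scalemxAl; congr (_ *: _).
    by rewrite -bv -row_mul mulmxV // row1.
  have := congr1 (fun u : 'rV_2 => u 0 i0) e.
  by rewrite !mxE /= mulr0.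
pose b (j : 'I_2) : 'M[F]_2 := \matrix_(r, s) if r == i1 then v 0 s else (s == j)%:R.
have rb j : row i1 (b j) = v by apply/rowP => s; rewrite !mxE eqxx.
have [v1|v1] := eqVneq (v 0 i1) 0; last first.
  by exists (b i0); split=> //; rewrite unitmxE det_mx2 !mxE /= unitfE mul1r mul0r subr0.
exists (b i1); split=> //; rewrite unitmxE det_mx2 !mxE /= unitfE mul0r mul1r sub0r oppr_eq0.
apply: contraNneq v0 => v2; apply/eqP/rowP => s; rewrite mxE.
by case: s => [[|[|//]]] Hs; [rewrite -[RHS]v2|rewrite -[RHS]v1]; congr (v _ _); apply: val_inj.
Qed.

Lemma trace_symp_rec (F : closedFieldType) n (g : 'M[F]_2) :
  \tr (symp n.+2 g) = \tr g * \tr (symp n.+1 g) - \det g * \tr (symp n g).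
Proof.
have [b [c [cb /(trace_symp_rec_trig n)]]] := trigonalize2 g.
rewrite !symp_conj // mxtrace_mulC mulmxA cb mul1mx.
have dbc : \det b * \det c = 1 by rewrite -det_mulmx (mulmx1C cb) det1.
by rewrite !det_mulmx [\det b * _ * _]mulrAC dbc mul1r.
Qed.

(** * Exact computation of the traces in Z[w] *)

Section Evaluation.
Variables (R : comNzRingType) (w : R).
Hypothesis w2 : w * w = - 1 - w.

Definition ev (x : eis) : R := x.1%:~R + x.2%:~R * w.

Lemma evD x y : ev (eadd x y) = ev x + ev y.
Proof. by rewrite /ev /= !rmorphD /=; ring. Qed.

Lemma evN x : ev (eopp x) = - ev x.
Proof. by rewrite /ev /= !rmorphN /=; ring. Qed.

Lemma evM x y : ev (emul x y) = ev x * ev y.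
Proof.
rewrite /ev /= !(rmorphD, rmorphB, rmorphM) /=.
have -> : (x.1%:~R + x.2%:~R * w) * (y.1%:~R + y.2%:~R * w) =
  x.1%:~R * y.1%:~R + (x.1%:~R * y.2%:~R + x.2%:~R * y.1%:~R) * w
  + x.2%:~R * y.2%:~R * (w * w) by ring.
by rewrite w2; ring.
Qed.

Definition to_mx (m : emat) : 'M[R]_2 := \matrix_(i, j)
  ev (if i == i0 then if j == i0 then m.1.1 else m.1.2
      else if j == i0 then m.2.1 else m.2.2).

Lemma to_mxM m n : to_mx (emmul m n) = to_mx m *m to_mx n.
Proof.
apply/matrixP => i j; rewrite !mxE !big_ord_recl big_ord0 addr0 !mxE.
by case: (i == i0); case: (j == i0); rewrite /= evD !evM.
Qed.

Lemma to_mx1 : to_mx eone = 1%:M.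
Proof.
apply/matrixP => i j; rewrite !mxE /ev.
by case: i j => [[|[|//]] ?] [[|[|//]] ?]; rewrite /= mul0r addr0.
Qed.

Lemma det_to_mx m : \det (to_mx m) = ev (edet m).
Proof. by rewrite det_mx2 !mxE /= /edet evD evN !evM. Qed.

Lemma trace_to_mx m : \tr (to_mx m) = ev (eadd m.1.1 m.2.2).
Proof. by rewrite trace_mx2 !mxE /= evD. Qed.
End Evaluation.

Definition trdet (m : emat) : eis * eis := (eadd m.1.1 m.2.2, edet m).

(* (h_n, h_(n+1)) |-> (h_(n+1), h_(n+2)) for the traces h_n of the symmetric powers
   of a matrix with trace and determinant k. *)
Definition trace_step (k : eis * eis) (x : eis * eis) : eis * eis :=
  (x.2, eadd (emul k.1 x.2) (eopp (emul k.2 x.1))).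
Definition sym_trace (n : nat) (k : eis * eis) : eis :=
  (iter n (trace_step k) ((1, 0), k.1)).1.

Lemma trace_symp_ev (F : closedFieldType) (w : F) (w2 : w * w = - 1 - w) n m :
  \tr (symp n (to_mx w m)) = ev w (sym_trace n (trdet m)).
Proof.
rewrite /sym_trace; set k := trdet m; set x0 := (_, _).
suff H : \tr (symp n (to_mx w m)) = ev w (iter n (trace_step k) x0).1 /\
    \tr (symp n.+1 (to_mx w m)) = ev w (iter n (trace_step k) x0).2 by case: H.
elim: n => [|n [IH1 IH2]].
  by rewrite trace_symp0 trace_symp1 trace_to_mx /ev /= mul0r addr0.
split; first exact: IH2.
rewrite trace_symp_rec IH1 IH2 trace_to_mx det_to_mx //=.
by rewrite [RHS]evD evN !evM.
Qed.

Definition sgz_of (b : bool) : int := if b then -1 else 1.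

(** The stabilizers have orders 72, 36 and 72, so over the common denominator 72 their averages
    enter the alternating sum with coefficients 1, -2, 1. *)
Definition weights : seq (int * (eis * eis)) :=
  [seq (sgz_of p.1, trdet (val p.2)) | p <- S0] ++
  [seq (-2 * sgz_of p.1, trdet (val p.2)) | p <- S1] ++
  [seq (sgz_of p.1, trdet (val p.2)) | p <- S2].

Definition scalar_keys : seq (eis * eis) :=
  [seq trdet (val (gl2_z ^+ k)%g) | k <- iota 0 6].

(** Distinct eigenvalues r, s give traces (r^(n+1) - s^(n+1)) / (r - s). For the nonscalar
    stabilizer elements r and s are twelfth roots of unity, whence the period 12. *)
Definition periodic (k : eis * eis) : bool :=
  iter 12 (trace_step k) ((1, 0), k.1) == ((1, 0), k.1).

Definition weights_periodic := [seq p <- weights | periodic p.2].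

(** A scalar c has trace (n+1) c^n, which is not periodic. Each scalar occurs once in every
    stabilizer, and all remaining elements pass the test [periodic]. *)
Lemma weights_perm : perm_eq weights
  ([seq (1 : int, k) | k <- scalar_keys] ++ [seq (-2 : int, k) | k <- scalar_keys] ++
   [seq (1 : int, k) | k <- scalar_keys] ++ weights_periodic).
Proof. by vm_compute. Qed.

Lemma sym_trace_periodic n k : periodic k -> sym_trace n k = sym_trace (n %% 12) k.
Proof.
move=> /eqP H; rewrite /sym_trace {1}(divn_eq n 12) addnC iterD.
congr (iter _ _ _).1; elim: (n %/ 12)%N => // q IH.
by rewrite mulSn iterD IH H.
Qed.

Definition weighted_sum n (W : seq (int * (eis * eis))) : eis :=
  foldr (fun p x => eadd (emul (p.1, 0) (sym_trace n p.2)) x) (0, 0) W.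

Lemma weighted_sum_periodic n : (n < 12)%N ->
  weighted_sum n weights_periodic = (if (n %% 6 == 0)%N then 72 else 0, 0).
Proof.
move=> ln; apply/eqP.
have /allP/(_ n) : all (fun n => weighted_sum n weights_periodic ==
   (if (n %% 6 == 0)%N then 72 else 0, 0)) (iota 0 12) by vm_compute.
by rewrite mem_iota; apply.
Qed.

Lemma sum_ev (R : comNzRingType) (w : R) (w2 : w * w = - 1 - w) n W :
  \sum_(p <- W) p.1%:~R * ev w (sym_trace n p.2) = ev w (weighted_sum n W).
Proof.
elim: W => [|p W IH]; first by rewrite big_nil /ev mul0r addr0.
by rewrite big_cons IH [RHS]evD (evM w2) [ev w (p.1, 0)]/ev mul0r addr0.
Qed.

Lemma weights_sum (R : comNzRingType) (w : R) (w2 : w * w = - 1 - w) n :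
  \sum_(p <- weights) p.1%:~R * ev w (sym_trace n p.2) =
  (if (n %% 6 == 0)%N then 72 else 0).
Proof.
have wP p : p \in weights_periodic -> periodic p.2 by rewrite mem_filter => /andP[].
have := @weighted_sum_periodic (n %% 12) (ltn_pmod n (isT : (0 < 12)%N)).
rewrite (modn_dvdm n (isT : (6 %| 12)%N)) (perm_big _ weights_perm).
move: scalar_keys weights_periodic wP => ks W wP HW; rewrite !big_cat !big_map /=.
rewrite [\sum_(p <- W) _](_ : _ = ev w (weighted_sum (n %% 12) W)).
  rewrite HW !addrA -!big_split /= big1 ?add0r; last by move=> k _; ring.
  by rewrite /ev mul0r addr0; case: ifP.
rewrite -sum_ev // !big_seq; apply: eq_bigr => p /wP pp.
by rewrite sym_trace_periodic.
Qed.

Lemma mul_bases_idem (K : fieldType) n (e : 'M[K]_n) : e *m e = e ->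
  row_base e *m col_base e = 1%:M.
Proof.
have /row_fullP[B BC] := col_base_full e; have /row_freeP[D RD] := row_base_free e.
have := mulmx_base e; move: (row_base e) (col_base e) B D BC RD => r c B D BC RD ce ee.
have : B *m (c *m r *m (c *m r)) *m D = B *m (c *m r) *m D by rewrite ce ee.
by rewrite !mulmxA BC !mul1mx -!mulmxA RD mulmx1.
Qed.

Lemma mxtrace_idem (K : fieldType) n (e : 'M[K]_n) : e *m e = e -> \tr e = (\rank e)%:R.
Proof. by move=> ee; rewrite -{1}(mulmx_base e) mxtrace_mulC mul_bases_idem // mxtrace1. Qed.

Lemma dim_fixed_idem (K : fieldType) n (e : 'M[K]_n) : e *m e = e ->
  \dim (fixedSpace (linfun (mulmx e : 'cV[K]_n -> 'cV[K]_n))) = \rank e.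
Proof.
move=> ee; pose f := linfun (mulmx (col_base e) : 'cV[K]_(\rank e) -> 'cV[K]_n).
have /row_fullP[B BC] := col_base_full e.
suff -> : fixedSpace (linfun (mulmx e : 'cV[K]_n -> 'cV[K]_n)) = (f @: fullv)%VS.
  rewrite limg_dim_eq ?dimvf /dim /= ?muln1 //.
  apply/eqP; rewrite -subv0; apply/subvP => v; rewrite memv_cap memv_ker lfunE /= memv0.
  by case/andP => _ /eqP e0; rewrite -[v]mul1mx -BC -mulmxA e0 mulmx0.
apply/vspaceP => v; apply/fixedSpaceP/memv_imgP => [|[u _ ->]].
  rewrite lfunE /= => ev; exists (row_base e *m v); first exact: memvf.
  by rewrite lfunE /= mulmxA mulmx_base.
have ec : e *m col_base e = col_base e.
  by rewrite -[X in X *m _](mulmx_base e) -mulmxA mul_bases_idem // mulmx1.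
by rewrite !lfunE /= mulmxA ec.
Qed.

(** * Dimensions of the invariants in symmetric powers *)

Section SymmetricPowerCohomology.
Variables (K : fieldType) (wK : K) (iota : {rmorphism K -> algC}).
Hypothesis wK2 : wK * wK = - 1 - wK.
Variable n : nat.

Lemma charK k : k.+1%:R != 0 :> K.
Proof. by rewrite -(fmorph_eq0 iota) rmorph_nat pnatr_eq0. Qed.

Definition srep (g : gl2) : 'M[K]_(n.+1) := symp n (to_mx wK (val g)).
Definition sact (g : gl2) (v : 'cV[K]_(n.+1)) : 'cV[K]_(n.+1) := srep g *m v.

Lemma sactM g h v : sact (g * h)%g v = sact g (sact h v).
Proof. by rewrite /sact /srep /= (to_mxM wK2) sympM mulmxA. Qed.

Lemma sact1 v : sact 1%g v = v.
Proof. by rewrite /sact /srep /= to_mx1 symp1 mul1mx. Qed.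

Lemma sactP g k u v : sact g (u + k *: v) = sact g u + k *: sact g v.
Proof. by rewrite /sact mulmxDr -scalemxAr. Qed.

Definition lmx (E : seq (K * gl2)) : 'M[K]_(n.+1) := \sum_(p <- E) p.1 *: srep p.2.

Lemma lmxE E v : lact sact E v = lmx E *m v.
Proof.
by rewrite /lact /lmx mulmx_suml; apply: eq_bigr => p _; rewrite -scalemxAl.
Qed.

Lemma lmx_idem (gens S : seq (bool * gl2)) :
  (forall (V : lmodType K) (phi : gl2 -> V),
    (forall p, p \in gens -> semi_inv phi p) -> forall p, p \in S -> semi_inv phi p) ->
  (forall g, g \in gens -> perm_eq [seq (g.1 (+) p.1, (g.2 * p.2)%g) | p <- S] S) ->
  (0 < size S)%N -> lmx (idem_list K S) *m lmx (idem_list K S) = lmx (idem_list K S).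
Proof.
move=> genS permS sizeS; set e := lmx _.
have H (v : 'cV[K]_(n.+1)) : e *m (e *m v) = e *m v.
  rewrite -!lmxE; apply/(inA_inv sactM sact1 sactP).
  apply: (inA_ext (radd_inv sactM sactP _ v)).
  exact: (inA_radd_idem charK genS permS).
apply/matrixP => i j; have := congr1 (fun u : 'cV_n.+1 => u i 0) (H (delta_mx j 0)).
by rewrite /= mulmxA -!colE !mxE.
Qed.

(** The trace is transported to [algC] because the trace recurrence rests on triangular form over a
    closed field. *)
Lemma trace_lmx (S : seq (bool * gl2)) : (0 < size S)%N ->
  (size S)%:R * iota (\tr (lmx (idem_list K S))) =
  \sum_(p <- S) (sgz_of p.1)%:~R * ev (iota wK) (sym_trace n (trdet (val p.2))).
Proof.
move=> sS; have w2 : iota wK * iota wK = - 1 - iota wK.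
  by rewrite -rmorphM wK2 rmorphB rmorphN rmorph1.
rewrite /lmx /idem_list big_map (raddf_sum (@mxtrace _ _)) rmorph_sum mulr_sumr /=.
apply: eq_bigr => p _; rewrite mxtraceZ rmorphM mulrA; congr (_ * _).
  rewrite rmorphM fmorphV rmorph_nat mulrA mulfV ?mul1r; last first.
    by rewrite pnatr_eq0; case: (size S) sS.
  by rewrite rmorphXn rmorphN rmorph1; case: p.1.
rewrite -(trace_symp_ev w2) -trace_map_mx; congr (\tr _).
apply/matrixP => i k; rewrite !mxE -coef_map; congr (_`_i).
have E c d : map_poly iota ((ev wK c)%:P + (ev wK d)%:P * 'X) =
    (ev (iota wK) c)%:P + (ev (iota wK) d)%:P * 'X.
  by rewrite rmorphD rmorphM /= !map_polyC map_polyX /= /ev !rmorphD !rmorphM !rmorph_int.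
by rewrite rmorphM !rmorphXn /= /sym_col0 /sym_col1 !mxE !E.
Qed.

Lemma dim_combination (i0 i1 i2 : nat) :
  (i0%:R = \tr (lmx (idem_list K S0))) -> (i1%:R = \tr (lmx (idem_list K S1))) ->
  (i2%:R = \tr (lmx (idem_list K S2))) ->
  i0%:Z - i1%:Z + i2%:Z = if (n %% 6 == 0)%N then 1 else 0.
Proof.
move=> H0 H1 H2.
have w2 : iota wK * iota wK = - 1 - iota wK.
  by rewrite -rmorphM wK2 rmorphB rmorphN rmorph1.
have E (S : seq (bool * gl2)) i : (i%:R = \tr (lmx (idem_list K S))) -> (0 < size S)%N ->
    \sum_(p <- S) (sgz_of p.1)%:~R * ev (iota wK) (sym_trace n (trdet (val p.2))) =
    (size S)%:R * i%:R :> algC.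
  by move=> Hi sS; rewrite -trace_lmx // -Hi rmorph_nat.
have E' : \sum_(p <- S1) (-2 * sgz_of p.1)%:~R * ev (iota wK) (sym_trace n (trdet (val p.2))) =
   -2 * ((size S1)%:R * i1%:R) :> algC.
  by rewrite -(E S1 i1 H1 isT) mulr_sumr; apply: eq_bigr => p _;
    rewrite rmorphM /= -mulrA rmorphN.
have s0 : size S0 = 72%N by []. have s1 : size S1 = 36%N by []. have s2 : size S2 = 72%N by [].
have := weights_sum w2 n; rewrite /weights.
move: E' (E S0 i0 H0 isT) (E S2 i2 H2 isT); rewrite s0 s1 s2.
move: (S0) (S1) (S2) => T0 T1 T2 E1 E0 E2; rewrite !big_cat !big_map /= E0 E1 E2 => H.
apply/eqP; rewrite -(eqr_int algC); apply/eqP; apply: (@mulfI _ 72); first by rewrite pnatr_eq0.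
rewrite rmorphD rmorphB /= -!pmulrn.
have -> : 72 * (i0%:R - i1%:R + i2%:R) =
  72 * i0%:R + (-2 * (36 * i1%:R) + 72 * i2%:R) :> algC by ring.
by rewrite H; case: ifP; rewrite ?mulr1 ?mulr0.
Qed.

Theorem sact_barH_euler : exists d : nat -> nat,
  [/\ forall j, barH sact j (d j), forall j, (2 < j)%N -> d j = 0%N &
      (d 0%N)%:Z - (d 1%N)%:Z + (d 2%N)%:Z = if (n %% 6 == 0)%N then 1 else 0].
Proof.
pose fx S := fixedSpace (linfun (mulmx (lmx (idem_list K S)) : 'cV[K]_n.+1 -> 'cV[K]_n.+1)).
pose df E := linfun (mulmx (lmx E) : 'cV[K]_n.+1 -> 'cV[K]_n.+1).
have fxP S v : v \in fx S <-> lact sact (idem_list K S) v = v.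
  by rewrite lmxE; split=> [/fixedSpaceP|H]; [|apply/fixedSpaceP]; rewrite lfunE.
have dfP E v : df E v = lact sact E v by rewrite lmxE lfunE.
have [d [d1 d2 d3]] := gl2_barH_euler charK sactM sact1 sactP (fxP S0) (fxP S1) (fxP S2)
  (dfP (D0_list K)) (dfP (D1_list K)).
exists d; split=> //; rewrite d3; apply: dim_combination; rewrite dim_fixed_idem ?mxtrace_idem //.
- exact: (lmx_idem (@S0_gen K) S0_perm).
- exact: (lmx_idem (@S0_gen K) S0_perm).
- exact: (lmx_idem (@S1_gen K) S1_perm).
- exact: (lmx_idem (@S1_gen K) S1_perm).
- exact: (lmx_idem (@S2_gen K) S2_perm).
- exact: (lmx_idem (@S2_gen K) S2_perm).
Qed.
End SymmetricPowerCohomology.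

(** * Transfer to the cochains of the statement *)

Lemma xi3_sq : xi3 * xi3 = - 1 - xi3.
Proof.
have s3 : sqrtC (-3) * sqrtC (-3) = -3 :> algC by rewrite -expr2 sqrtCK.
have -> : xi3 * xi3 = (1 - 2 * sqrtC (-3) + sqrtC (-3) * sqrtC (-3)) / 4.
  by rewrite /xi3; field.
by rewrite s3 /xi3; field.
Qed.

(** Replaces the predicate [inQxi] by a genuine field, over which dimensions of vector spaces make
    sense. Powers of xi3 are reduced by [xi3_sq]. *)
Lemma Qxi_field : exists (K : fieldType) (iota : {rmorphism K -> algC}) (w : K),
  [/\ iota w = xi3, forall k, inQxi (iota k) & forall x, inQxi x -> exists k, iota k = x].
Proof.
have [Qs [QsC [[|w [|]] // [Dw] genQ]]] := num_field_exists [:: xi3].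
have rat_QsC (q : rat) : QsC q%:A = ratr q.
  by rewrite -(fmorph_eq_rat (QsC \o in_alg Qs)).
exists Qs, QsC, w; split=> // [k|x [a [b ->]]]; last first.
  by exists (a%:A + b%:A * w); rewrite rmorphD rmorphM /= !rat_QsC Dw.
have : k \in <<1 & [:: w]>>%VS by rewrite genQ memvf.
rewrite adjoin_seq1 => /Fadjoin_polyP[p /polyOverP pQ ->].
rewrite horner_coef rmorph_sum; apply: (big_ind inQxi) => [|x y|i _].
- by exists 0, 0; rewrite !rmorph0 mul0r addr0.
- move=> [a [b ->]] [c [d ->]]; exists (a + c), (b + d); rewrite !rmorphD /=; ring.
have /vlineP[q ->] := pQ i; rewrite rmorphM /= rat_QsC rmorphXn /= Dw.
elim: (nat_of_ord i) => [|j [a [b ab]]].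
  by exists q, 0; rewrite rmorph0 mul0r addr0 mulr1.
exists (- b), (a - b); rewrite exprS mulrCA ab mulrDr [xi3 * (_ * xi3)]mulrCA xi3_sq.
by rewrite !(rmorphN, rmorphB) /=; ring.
Qed.

(** Multiplying a vanishing difference by its conjugate shows that its norm is 0. *)
Lemma ev_xi3_inj : injective (ev xi3).
Proof.
move=> x y e; have : ev xi3 (eadd x (eopp y)) = 0 by rewrite evD evN e subrr.
move=> /(congr1 ( *%R^~ (ev xi3 (econj (eadd x (eopp y)))))).
rewrite mul0r -(evM xi3_sq).
have -> v : emul v (econj v) = (enorm v, 0).
  by case: v => p q; rewrite /emul /econj /enorm /=; congr (_, _); ring.
rewrite /ev mul0r addr0 => /eqP; rewrite intr_eq0 => /eqP/enorm_eq0.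
by case: x y {e} => [p q] [u v] [] /eqP + /eqP; rewrite !subr_eq0 => /eqP-> /eqP->.
Qed.

Definition gl2_mx (x : gl2) : 'M[algC]_2 := to_mx xi3 (val x).

Lemma gl2_mxM x y : gl2_mx (x * y)%g = gl2_mx x *m gl2_mx y.
Proof. exact: (to_mxM xi3_sq). Qed.

Lemma gl2_mx_inj : injective gl2_mx.
Proof.
move=> x y /matrixP e; apply: val_inj.
have := e i0 i0; have := e i0 i1; have := e i1 i0; have := e i1 i1.
rewrite !mxE /= => /ev_xi3_inj + /ev_xi3_inj + /ev_xi3_inj + /ev_xi3_inj.
by case: (val x) (val y) => [[? ?] [? ?]] [[? ?] [? ?]] /= -> -> -> ->.
Qed.

Lemma inZxi_ev x : inZxi (ev xi3 x).
Proof. by exists x.1, x.2. Qed.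

Lemma inGL2ZxiP g : inGL2Zxi g <-> exists x, gl2_mx x = g.
Proof.
split=> [[gZ [u [[c [d Du]] gu]]]|[x <-]]; last first.
  split=> [i j|]; first by rewrite mxE; apply: inZxi_ev.
  exists (ev xi3 (econj (edet (val x)))); split; first exact: inZxi_ev.
  rewrite (det_to_mx xi3_sq).
  transitivity (ev xi3 (emul (edet (val x)) (econj (edet (val x))))).
    by rewrite (evM xi3_sq).
  have -> v : emul v (econj v) = (enorm v, 0).
    by case: v => p q; rewrite /emul /econj /enorm /=; congr (_, _); ring.
  by rewrite gl2_det /ev mul0r addr0.
have /choice[m mP] (p : 'I_2 * 'I_2) : exists e : eis, g p.1 p.2 = ev xi3 e.
  by have [a [b e]] := gZ p.1 p.2; exists (a, b).
pose m' : emat := ((m (i0, i0), m (i0, i1)), (m (i1, i0), m (i1, i1))).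
have gm : to_mx xi3 m' = g.
  apply/matrixP => i j; rewrite mxE.
  have I2 (k : 'I_2) : k = i0 \/ k = i1.
    by case: k => [[|[|//]] ?]; [left|right]; apply: val_inj.
  by case: (I2 i) (I2 j) => [-> [->|->]|-> [->|->]]; apply: (esym (mP (_, _))).
suff /eqP H : enorm (edet m') = 1 by exists (@mk_gl2 m' H).
have {gu} : ev xi3 (emul (edet m') (c, d)) = ev xi3 (1, 0).
  rewrite (evM xi3_sq) -(det_to_mx xi3_sq) gm [RHS]/ev mul0r addr0.
  by rewrite -[ev xi3 _]/(c%:~R + d%:~R * xi3) -Du.
move/ev_xi3_inj/(congr1 enorm); rewrite enormM (_ : enorm (1, 0) = 1) // => H.
have unit_ge0 (p q : int) : 0 <= p -> 0 <= q -> p * q = 1 -> p = 1.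
  move=> p0 q0 pq; have p1 : p != 0 by apply/eqP => p0'; rewrite p0' mul0r in pq.
  have q1 : q != 0 by apply/eqP => q0'; rewrite q0' mulr0 in pq.
  have : 0 <= (p - 1) * (q - 1) by apply: mulr_ge0; lia.
  by rewrite mulrBl !mulrBr pq; lia.
exact: unit_ge0 (enorm_ge0 _) (enorm_ge0 _) H.
Qed.

(** Inverse of [gl2_mx] by choice, with the arbitrary value 1 off its image. *)
Definition mx_gl2 (g : 'M[algC]_2) : gl2 :=
  if pselect (exists x, gl2_mx x = g) is left e then projT1 (cid e) else 1%g.

Lemma gl2_mxK : cancel gl2_mx mx_gl2.
Proof.
move=> x; rewrite /mx_gl2; case: pselect => [e|[]]; last by exists x.
by apply: gl2_mx_inj; case: (cid e).
Qed.

Lemma map_gl2_mxK s : map mx_gl2 (map gl2_mx s) = s.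
Proof. by rewrite (mapK gl2_mxK). Qed.

Lemma allGamma_map s : allGamma (map gl2_mx s).
Proof. by move=> g /mapP[x _ ->]; apply/inGL2ZxiP; exists x. Qed.

Lemma allGammaP s : allGamma s -> exists s', s = map gl2_mx s'.
Proof.
elim: s => [|g s IH] H; first by exists [::].
have [|s' ->] := IH; first by move=> h hs; apply: H; rewrite inE hs orbT.
have /inGL2ZxiP[x <-] := H g (mem_head _ _).
by exists (x :: s').
Qed.

Section Transfer.
Variables (K : fieldType) (wK : K) (iota : {rmorphism K -> algC}) (n : nat).
Hypothesis iw : iota wK = xi3.
Hypothesis iQ : forall k, inQxi (iota k).
Hypothesis Qi : forall x, inQxi x -> exists k, iota k = x.
Local Notation V := 'cV[K]_(n.+1).
Local Notation act := (sact wK (n := n)).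

Lemma wK_sq : wK * wK = - 1 - wK.
Proof. by apply: (fmorph_inj iota); rewrite rmorphM rmorphB rmorphN rmorph1 iw xi3_sq. Qed.

Lemma symmx_map x : symmx n (gl2_mx x) = map_mx iota (srep wK n x).
Proof.
apply/matrixP => i k; rewrite !mxE -coef_map; congr (_`_i).
have E c d : map_poly iota ((ev wK c)%:P + (ev wK d)%:P * 'X) =
    (ev xi3 c)%:P + (ev xi3 d)%:P * 'X.
  have F e : iota (ev wK e) = ev xi3 e by rewrite /ev rmorphD rmorphM !rmorph_int iw.
  by rewrite rmorphD rmorphM /= !map_polyC map_polyX /= !F.
by rewrite rmorphM !rmorphXn /= /sym_col0 /sym_col1 !mxE !E.
Qed.

Definition lift_cochain (F : seq gl2 -> V) : cochain n :=
  fun s => map_mx iota (F (map mx_gl2 s)).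

(** Agreement is asked only on sequences of length j in the group, the only place where a cochain of
    the statement is constrained. *)
Definition descends (j : nat) (f : cochain n) (F : seq gl2 -> V) : Prop :=
  forall s, size s = j -> f (map gl2_mx s) = map_mx iota (F s).

Lemma lift_descends j F : descends j (lift_cochain F) F.
Proof. by move=> s _; rewrite /lift_cochain map_gl2_mxK. Qed.

Lemma lift_is_cochain j F : is_cochain j (lift_cochain F).
Proof. by move=> s _ _ i; rewrite mxE. Qed.

Lemma cochain_descends j f : is_cochain j f -> exists F, descends j f F.
Proof.
move=> fC; have /choice[F FP] : forall s : seq gl2, exists v : V,
    size s = j -> f (map gl2_mx s) = map_mx iota v.
  move=> s; have [Hs|/eqP nHs] := eqVneq (size s) j; last by exists 0 => /nHs.
  have /choice[v vP] i : exists k, iota k = f (map gl2_mx s) i 0.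
    by apply: Qi; apply: fC; [exact: allGamma_map|rewrite size_map].
  exists (\col_i v i) => _; apply/matrixP => i k.
  by rewrite !mxE vP (ord1 k).
by exists F.
Qed.

Lemma dcoch_descends j f F s x : descends j f F -> size s = j.+1 ->
  dcoch j f (map gl2_mx s) = map_mx iota (bard act j (cst F) s x).
Proof.
move=> fF Hs; rewrite /dcoch /bard /cst !map_mxD !map_mxZ.
have -> (k : nat) : iota ((-1) ^+ k) = (-1) ^+ k by rewrite rmorphXn rmorphN rmorph1.
congr (_ + _ + _).
- case: s Hs => // g s [Hs] /=; rewrite symmx_map fF // /sact map_mxM //.
- rewrite raddf_sum; apply: eq_bigr => i _; have Hi := ltn_ord i.
  rewrite /= map_mxZ rmorphXn rmorphN rmorph1 -fF; last first.
    by rewrite size_cat size_take /= size_drop Hs; case: ifP; lia.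
  congr (_ *: f _); rewrite map_cat map_take /= map_drop gl2_mxM.
  (* Both indices are in range, so the different default values 0 and 1 never occur. *)
  by rewrite !(nth_map 1%g) ?Hs //; lia.
- by rewrite -map_take fF // size_take Hs ltnSn.
Qed.

Lemma map_mx_iota_inj (u v : V) : map_mx iota u = map_mx iota v -> u = v.
Proof.
move=> /matrixP e; apply/matrixP => i k; apply: (fmorph_inj iota).
by have := e i k; rewrite !mxE.
Qed.

Lemma vcocP j f F : descends j f F -> is_cocycle j f -> vcoc act j F.
Proof.
move=> fF [_ df] s x Hs; apply: map_mx_iota_inj.
rewrite -(dcoch_descends x fF Hs) df ?size_map ?map_mx0 //; exact: allGamma_map.
Qed.

Lemma is_cocycleP j F : vcoc act j F -> is_cocycle j (lift_cochain F).
Proof.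
move=> dF; split=> [|_ /allGammaP[s ->]]; first exact: lift_is_cochain.
rewrite size_map => Hs.
by rewrite (dcoch_descends 1%g (@lift_descends j F) Hs) dF // map_mx0.
Qed.

Lemma coboundaryP j f F : descends j f F -> is_coboundary j f <-> vcob act j F.
Proof.
case: j => [|j] fF /=.
  have e := fF [::] (erefl _); split=> [f0|F0].
    by apply: map_mx_iota_inj; rewrite -e /= f0 map_mx0.
  by rewrite -[[::]]/(map gl2_mx [::]) e F0 map_mx0.
split=> [[h [hC hf]]|[h hF]].
  have [H hH] := cochain_descends hC; exists H => s x Hs; apply: map_mx_iota_inj.
  rewrite -(dcoch_descends x hH Hs) -fF // hf ?size_map //; exact: allGamma_map.
exists (lift_cochain h); split; first exact: lift_is_cochain.
move=> _ /allGammaP[s ->]; rewrite size_map => Hs.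
by rewrite (dcoch_descends 1%g (@lift_descends j h) Hs) fF // -hF.
Qed.

Lemma dimH_of_barH j d : barH act j d -> dimH n j d.
Proof.
move=> [Z [Zc Zspan Zfree]]; exists (fun i => lift_cochain (Z i)); split; [|split].
- by move=> i; apply: is_cocycleP.
- move=> f fc; have [F fF] := cochain_descends fc.1.
  have [c cP] := Zspan F (vcocP fF fc); exists (fun i => iota (c i)); split=> //.
  apply/coboundaryP; last exact: cP.
  move=> s Hs; rewrite fF // map_mxB; congr (_ - _); rewrite raddf_sum; apply: eq_bigr => i _.
  by rewrite /= map_mxZ (lift_descends (Z i) Hs).
move=> c cQ /coboundaryP H.
have /choice[k kP] i : exists k, iota k = c i by apply: Qi.
suff k0 : forall i, k i = 0 by move=> i; rewrite -kP k0 rmorph0.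
apply: Zfree; apply: H => s Hs; rewrite raddf_sum; apply: eq_bigr => i _.
by rewrite /= map_mxZ kP (lift_descends (Z i) Hs).
Qed.
End Transfer.

Theorem theorem8p8 (n : nat) :
  chi_h_is n (if (n %% 6 == 0)%N then 1 else 0).
Proof.
have [K [iota [w [iw iQ Qi]]]] := Qxi_field.
have [d [dP dvan dsum]] := sact_barH_euler iota (wK_sq iw) n.
exists 2, d; split; [|split] => [j|j|].
- exact: (dimH_of_barH iw iQ Qi (dP j)).
- exact: dvan.
by rewrite -dsum !big_ord_recl big_ord0 /= expr0 expr1 sqrrN expr1n !mul1r mulN1r addr0 addrA.
Qed.
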